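(* For all $0<\beta<1$ there exist $\lambda^*=\lambda^*(\beta)<\sqrt{2}$, $n^*\geq 0$ and $\gamma<1$ such that for all $0<\lambda<\lambda^*$ and all $n>n^*$, a random configuration $\sigma$ of $n$ particles drawn from the stationary distribution $\pi$ of the Markov chain $\mathcal{M}$ with bias parameter $\lambda$ satisfies $$\mathbb{P}\left(p(\sigma) < \beta\cdot p_{max}\right) \leq \gamma^{\sqrt{n}},$$ where $p_{max}=2n-2$.
   Context: Let $\Gamma$ be the triangular lattice. A configuration of $n$ particles is a set of $n$ vertices (''locations'') of $\Gamma$, considered up to translation (rotated copies count as distinct). The configuration is connected if the subgraph of $\Gamma$ induced by the occupied locations is connected. A hole is a maximal finite connected set of unoccupied locations. For a connected configuration $\sigma$ with no holes, $p(\sigma)$ is the length of the closed walk around its single external boundary (an edge traversed twice is counted twice). The Markov chain $\mathcal{M}$ (bias $\lambda>0$) has state space $\Omega$, the set of connected configurations of $n$ particles with no holes. For a location $\ell$, $N(\ell)$ is the set of particles at locations adjacent to $\ell$. For adjacent $\ell,\ell'$, let $\mathbb{S}=N(\ell)\cap N(\ell')$ and $N(\ell\cup\ell')=(N(\ell)\cup N(\ell'))$ minus particles located at $\ell$ or $\ell'$. Property 1: $|\mathbb{S}|\in\{1,2\}$ and every particle in $N(\ell\cup\ell')$ is connected to a particle of $\mathbb{S}$ by a lattice path all of whose vertices are particles of $N(\ell\cup\ell')$. Property 2: $|\mathbb{S}|=0$; each of $\ell,\ell'$ has at least one adjacent particle other than one located at the other location; the particles of $N(\ell)$ not at $\ell'$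 are connected by paths within this set; the particles of $N(\ell')$ not at $\ell$ are connected by paths within this set. One step from $\sigma$: choose a particle $P$ uniformly (location $\ell$), a neighbor $\ell'$ of $\ell$ uniformly among six, and $q$ uniform in $(0,1)$. If $\ell'$ is occupied, do nothing. Otherwise let $t$ (resp. $t'$) be the number of triangular faces incident to $\ell$ (resp. $\ell'$) with all three vertices occupied when $P$ is at $\ell$ (resp. at $\ell'$); move $P$ to $\ell'$ if (1) $\ell$ does not have exactly five occupied neighbors, (2) $\ell,\ell'$ satisfy Property 1 or 2, and (3) $q<\lambda^{t'-t}$; else do nothing. $\pi$ is the stationary distribution of $\mathcal{M}$. *)

(* Defs.v *)
From HB Require Import structures.
From mathcomp Require Import all_boot all_order all_algebra.
From mathcomp Require Import finmap.
From mathcomp Require Import all_classical all_reals all_analysis.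

Set Implicit Arguments.
Unset Strict Implicit.
Unset Printing Implicit Defensive.

Import Order.TTheory GRing.Theory Num.Theory.
Local Open Scope fset_scope.
Local Open Scope classical_set_scope.
Local Open Scope ring_scope.

(* Triangular lattice in axial coordinates: location (x,y) is the point
   x*(1,0) + y*(1/2, sqrt3/2) of the plane. *)
Definition point := (int * int)%type.

Definition padd (a b : point) : point := (a.1 + b.1, a.2 + b.2).
Definition psub (a b : point) : point := (a.1 - b.1, a.2 - b.2).

(* The six lattice directions, in counterclockwise order (0,60,...,300 deg). *)
Definition dirs : seq point :=
  [:: (1, 0); (0, 1); (-1, 1); (-1, 0); (0, -1); (1, -1)].
Definition dir (i : nat) : point := nth (0, 0) dirs (i %% 6)%N.

Definition adj (a b : point) : bool := psub b a \in dirs.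

Definition lpath (S : set point) (a b : point) : Prop :=
  exists s : seq point, [/\ path adj a s, last a s = b & forall x, x \in s -> S x].

Definition connectedS (S : set point) : Prop :=
  forall a b, S a -> S b -> lpath S a b.

Definition cfg := {fset point}.
Definition occ (A : cfg) : set point := [set x | x \in A].

Definition is_connected (A : cfg) : Prop := connectedS (occ A).

Definition is_hole (A : cfg) (H : set point) : Prop :=
  [/\ finite_set H, H `<=` ~` occ A, connectedS H &
      forall K, finite_set K -> connectedS K -> K `<=` ~` occ A ->
                H `<=` K -> K = H].

Definition no_holes (A : cfg) : Prop := forall H, ~ is_hole A H.

(* canonical representative modulo translation: the particle maximizing
   (2x+y, y) lexicographically (i.e. rightmost, then topmost in the plane)
   is translated to the origin *)
Definition pbetter (a b : point) : bool :=
  (2 * b.1 + b.2 < 2 * a.1 + a.2) ||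
  ((2 * b.1 + b.2 == 2 * a.1 + a.2) && (b.2 < a.2)).
Definition anchor (A : cfg) : point :=
  foldr (fun a b => if pbetter a b then a else b) (head (0, 0) A) A.
Definition normalize (A : cfg) : cfg := [fset psub a (anchor A) | a in A].

Definition Omega (n : nat) : set cfg :=
  [set A | [/\ normalize A = A, #|` A| = n, is_connected A & no_holes A]].

(* ---------- perimeter p(sigma): length of the external boundary walk ----------
   State (v, s): at particle v, sweep directions s, s+1, ... (counterclockwise)
   from inside the external face until the first occupied neighbour w = v + dir j;
   walk to w; at w the external face continues from direction j+4.  The walk starts
   at the anchor particle with direction 0, which points into the external face. *)
Definition wstep (A : cfg) (st : point * nat) : point * nat :=
  let: (v, s) := st in
  let k := find (fun k => padd v (dir (s + k)%N) \in A) (iota 0 6) in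
  let j := ((s + k) %% 6)%N in
  (padd v (dir j), ((j + 4) %% 6)%N).

Definition perimeter (A : cfg) : nat :=
  let v0 := anchor A in
  if has (fun i => padd v0 (dir i) \in A) (iota 0 6) then
    let s1 := wstep A (v0, 0%N) in
    (find (fun k => iter k.+1 (wstep A) s1 == s1) (iota 0 (6 * #|` A|)%N)).+1
  else 0%N.

Definition Nb (A : cfg) (l : point) : cfg := [fset x in A | adj l x]%fset.

Definition property1 (A : cfg) (l l' : point) : Prop :=
  let S := [fset x in A | adj l x && adj l' x]%fset in
  let Nu := [fset x in A | (adj l x || adj l' x) && (x != l) && (x != l')]%fset in
  (#|` S| = 1 \/ #|` S| = 2)%N /\
  forall x, x \in Nu -> exists2 y, y \in S & lpath (occ Nu) x y.

Definition property2 (A : cfg) (l l' : point) : Prop :=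
  let S := [fset x in A | adj l x && adj l' x]%fset in
  [/\ #|` S| = 0%N,
      exists x, [/\ x \in A, adj l x & x != l'],
      exists x, [/\ x \in A, adj l' x & x != l],
      connectedS [set x | [/\ x \in A, adj l x & x != l']] &
      connectedS [set x | [/\ x \in A, adj l' x & x != l]]].

(* number of triangular faces at location v with all three vertices occupied *)
Definition tri (A : cfg) (v : point) : nat :=
  count (fun i => (padd v (dir i) \in A) && (padd v (dir i.+1) \in A)) (iota 0 6).

Definition moved (A : cfg) (l l' : point) : cfg := (l' |` (A `\ l))%fset.

Definition move_allowed (A : cfg) (l l' : point) : Prop :=
  [/\ l' \notin A, #|` Nb A l| <> 5%N & property1 A l l' \/ property2 A l l'].

(* probability that q uniform in (0,1) satisfies q < lambda^(t'-t) *)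
Definition accept {R : realType} (lam : R) (A : cfg) (l l' : point) : R :=
  Num.min 1 (lam ^ ((tri (moved A l l') l' : int) - (tri A l : int))).

Definition stepprob {R : realType} (lam : R) (A : cfg) (l : point) (i : nat)
    (tau : cfg) : R :=
  let l' := padd l (dir i) in
  if `[< move_allowed A l l' >] then
    accept lam A l l' * (normalize (moved A l l') == tau)%:R
    + (1 - accept lam A l l') * (A == tau)%:R
  else (A == tau)%:R.

Definition trans {R : realType} (lam : R) (sigma tau : cfg) : R :=
  (6 * (#|` sigma|)%:R)^-1 *
  \sum_(l <- sigma) \sum_(i < 6) stepprob lam sigma l i tau.

Definition stationary {R : realType} (lam : R) (n : nat) (pi : cfg -> R) : Prop :=
  [/\ forall s, Omega n s -> 0 <= pi s,
      \sum_(s \in Omega n) pi s = 1 &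
      forall t, Omega n t -> \sum_(s \in Omega n) pi s * trans lam s t = pi t].

Definition prob {R : realType} (n : nat) (pi : cfg -> R) (E : cfg -> Prop) : R :=
  \sum_(s \in [set s | Omega n s /\ E s]) pi s.

(* Main.v *)
Require Import Defs.
From HB Require Import structures.
From mathcomp Require Import all_boot all_order all_algebra.
From mathcomp Require Import finmap.
From mathcomp Require Import all_classical all_reals all_analysis.
From mathcomp Require Import zify ring lra.

Import Order.TTheory GRing.Theory Num.Theory.
Local Open Scope ring_scope.

(* Let T(A) be three times the number of occupied triangular faces and
   mu = lam^(1/3). Detailed balance holds for the weight mu^T, so a stationary pi
   is proportional to mu^T along allowed moves (the Dirichlet form of pi / mu^T
   vanishes), and its support is closed under allowed moves. From every
   configuration, allowed moves lead to one with at most one particle in each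
   column x = const, which has T = 0; hence pi <= mu^T pointwise. The boundary
   walk of a connected configuration without holes visits every corner of the
   boundary, which gives p >= 2n - 2 - T. So p < beta (2n - 2) forces
   T > (1 - beta)(2n - 2), and since there are at most 36^n configurations it
   suffices to take lam so small that mu^(1 - beta) <= 1/72.

   To reach such a thin configuration, sweep the columns from the left. In the
   first column with several particles, the top (or bottom) particle P is moved
   up along the next column until it can enter it. Where P is blocked because
   filling the next site would pinch off a pocket, the obstructing particle w is
   locally either removable, and then it can jump into that site, or a 120-degree
   bend pointing at it, and then it can be flipped away unless the same
   obstruction occurs two sites further along the ray; as the ray is finite the
   obstruction can always be resolved. *)

Set Implicit Arguments.
Unset Strict Implicit.
Unset Printing Implicit Defensive.

(* [point] is shadowed by the pointed types of MathComp-Analysis. *)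
Notation point := Defs.point.

(** * The triangular lattice *)

(** Everything is extracted from the given stationary [pi]. Summing its equation over all targets
    shows that no mass leaks out of [Omega], so an allowed move from a configuration of positive
    mass lands in [Omega] again and keeps the ratio of [pi] to the weight. The pointwise bound then
    needs just one path from each configuration of the support to some configuration of weight 1,
    whose mass is at most 1. This is why the reachability part speaks of an abstract predicate [U]
    closed under allowed moves; it also lets the same argument run on reflected configurations. The
    cube root appears because T counts each face at its three vertices, so a move changes T by 3(t'
    - t). The bound on p is local counting plus one global fact: a single boundary walk meets every
    corner. That fact is where the absence of holes enters; it is a discrete Jordan argument with
    Z/2 cochains. The constant 36 is 6^2: a configuration is coded by a tour of 2(n - 1) steps in
    six directions. Taking 72 leaves 2^(-n), which is below 2^(-sqrt n). *)

Definition nb (v : point) (i : nat) : point := padd v (dir i).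

Lemma paddA a b c : padd (padd a b) c = padd a (padd b c).
Proof. by rewrite /padd /= !addrA. Qed.

Lemma padd_inj a : injective (padd a).
Proof. by move=> [x y] [x' y'] [] /addrI -> /addrI ->. Qed.

Lemma paddr0 a : padd a (0, 0) = a.
Proof. by case: a => x y; rewrite /padd !addr0. Qed.

Lemma padd_subK a b : padd a (psub b a) = b.
Proof. by case: a b => [x y] [u v]; rewrite /padd /psub /= !subrKC. Qed.

Lemma adj_sym a b : adj a b = adj b a.
Proof. rewrite /adj /psub /dirs !inE !xpair_eqE; lia. Qed.

Lemma adj_padd l a b : adj (padd l a) (padd l b) = adj a b.
Proof.
rewrite /adj; suff -> : psub (padd l b) (padd l a) = psub b a by [].
by case: l a b => [x y] [a b] [c d]; rewrite /psub /padd /=; congr pair; ring.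
Qed.

Lemma adj_irr a : adj a a = false.
Proof. by rewrite /adj /psub !subrr. Qed.

Lemma dir_mod i : dir (i %% 6) = dir i.
Proof. by rewrite /dir modn_mod. Qed.

Lemma nb_mod v i : nb v (i %% 6) = nb v i.
Proof. by rewrite /nb dir_mod. Qed.

Lemma adj_nb v i : adj v (nb v i).
Proof.
rewrite -{1}[v]paddr0 /nb adj_padd -dir_mod.
by move: (i %% 6)%N (ltn_pmod i (isT : (0 < 6)%N)) => {i}; do 6?[case=> //].
Qed.

Lemma adjP v x : reflect (exists2 i, (i < 6)%N & x = nb v i) (adj v x).
Proof.
apply: (iffP idP) => [|[i _ ->]]; last exact: adj_nb.
rewrite /adj => /(nthP (0, 0)) [i i6 e]; exists i => //.
by rewrite /nb /dir modn_small // e padd_subK.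
Qed.

Lemma nbD v i j : nb (nb v i) j = padd v (padd (dir i) (dir j)).
Proof. exact: paddA. Qed.

Lemma dirM q j : dir (q * 6 + j) = dir j.
Proof. by rewrite /dir modnMDl. Qed.

Lemma dir_lt6 (Q : nat -> Prop) :
  (forall q r, Q r -> Q (q * 6 + r)%N) -> Q 0%N -> Q 1%N -> Q 2%N -> Q 3%N -> Q 4%N -> Q 5%N ->
  forall i, Q i.
Proof.
move=> H Q0 Q1 Q2 Q3 Q4 Q5 i; rewrite (divn_eq i 6); apply: H.
by move: (i %% 6)%N (ltn_pmod i (isT : (0 < 6)%N)); do 6?[case=> //].
Qed.

Lemma nbK v i : nb (nb v i) (i + 3) = v.
Proof.
rewrite nbD -[RHS]paddr0; congr padd.
by elim/dir_lt6: i => // q r; rewrite -addnA !dirM.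
Qed.

(* The three vertices v, v_i, v_(i+1) form a face. *)
Lemma nb_turn v i : nb (nb v i) (i + 2) = nb v i.+1.
Proof.
rewrite nbD /nb; congr padd.
by elim/dir_lt6: i => // q r; rewrite -addnA -addnS !dirM.
Qed.

Lemma nb_turnr v i : nb (nb v i.+1) (i + 5) = nb v i.
Proof. by rewrite -(nb_turn v i) -[RHS](nbK _ (i + 2)) -addnA. Qed.

(** * Lattice paths, growth of connected configurations, and spanning tours *)

Lemma lpath_refl (S : set point) a : lpath S a a.
Proof. by exists [::]. Qed.

Lemma lpath_trans (S : set point) b a c : lpath S a b -> lpath S b c -> lpath S a c.
Proof.
move=> [s [ps ls Ss]] [t [pt lt St]]; exists (s ++ t); split.
- by rewrite cat_path ps ls.
- by rewrite last_cat ls.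
- by move=> x; rewrite mem_cat => /orP[/Ss|/St].
Qed.

Lemma lpath1 (S : set point) a b : adj a b -> S b -> lpath S a b.
Proof.
by move=> ab Sb; exists [:: b]; split=> //= [|x]; rewrite ?ab // inE => /eqP ->.
Qed.

Lemma lpath_sub (S S' : set point) a b :
  (forall x, S x -> S' x) -> lpath S a b -> lpath S' a b.
Proof. by move=> SS' [s [ps ls Ss]]; exists s; split=> // x /Ss /SS'. Qed.

(* S a is needed: the starting point of an lpath is not required to lie in S. *)
Lemma lpath_sym (S : set point) a b : S a -> lpath S a b -> lpath S b a.
Proof.
move=> Sa [s [ps ls Ss]]; elim: s a Sa ps ls Ss => [|c s IH] a Sa /=.
  by move=> _ -> _; apply: lpath_refl.
move=> /andP[ac ps] ls Ss.
have Sc : S c by apply: Ss; rewrite inE eqxx.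
apply: lpath_trans (lpath1 _ Sa); last by rewrite adj_sym; exact: ac.
by apply: IH => // x xs; apply: Ss; rewrite inE xs orbT.
Qed.

Lemma lpath_inv (S Q : set point) a b :
  (forall x y, Q x -> S y -> adj x y -> Q y) -> Q a -> lpath S a b -> Q b.
Proof.
move=> inv Qa [s [ps ls Ss]]; elim: s a Qa ps ls Ss => [|c s IH] a Qa /=.
  by move=> _ <-.
move=> /andP[ac ps] ls Ss.
apply: (IH c) => // [|x xs]; last by apply: Ss; rewrite inE xs orbT.
by apply: inv ac => //; apply: Ss; rewrite inE eqxx.
Qed.

Section Grow.
Local Open Scope fset_scope.

Lemma boundary_step (A B : cfg) a : is_connected A -> B `<=` A -> a \in B -> B != A ->
  exists b c, [/\ b \in B, c \in A, c \notin B & adj b c].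
Proof.
move=> cA BA aB BnA.
have [c cA' cB] : exists2 c, c \in A & c \notin B.
  have /fsubsetPn[x xA xB] : ~~ (A `<=` B).
    by apply: contra BnA => AB; rewrite eqEfsubset BA.
  by exists x.
apply: contrapT => H.
have : [set x | x \in B]%classic c.
  apply: (lpath_inv (S := occ A) _ aB); last by apply: cA => //; apply: (fsubsetP BA).
  move=> x y /= xB yA xy; apply: contrapT => /negP yB.
  by apply: H; exists x, y.
by move=> /= cB'; rewrite cB' in cB.
Qed.

(** Induction along a spanning tree without naming the tree: as long as [B] is not all of [A],
    [boundary_step] supplies a new particle next to [B]. It gives both the tours of length 2(n - 1)
    and the lower bound on the sum of degrees. *)
Lemma grow_ind (A : cfg) a (Q : cfg -> Prop) : is_connected A -> a \in A ->
  Q [fset a] ->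
  (forall B b c, B `<=` A -> b \in B -> c \notin B -> adj b c -> Q B -> Q (c |` B)) ->
  Q A.
Proof.
move=> cA aA Q1 QS.
have H k : (k < #|` A|)%N -> exists B, [/\ B `<=` A, a \in B, #|` B| = k.+1 & Q B].
  elim: k => [|k IH] kA.
    by exists [fset a]; split; rewrite ?fsub1set ?inE ?cardfs1.
  have [B [BA aB cB QB]] := IH (ltnW kA).
  have BnA : B != A by apply: contraTneq kA => <-; rewrite cB ltnn.
  have [b [c [bB cA' cnB bc]]] := boundary_step cA BA aB BnA.
  exists (c |` B); split.
  - by rewrite fsubUset fsub1set cA' BA.
  - by rewrite !inE aB orbT.
  - by rewrite cardfsU1 cnB cB add1n.
  - exact: (QS _ b).
have A0 : (0 < #|` A|)%N by rewrite cardfs_gt0; apply/fset0Pn; exists a.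
have [|B [BA _ cB QB]] := H #|` A|.-1; first by rewrite prednK.
suff -> : A = B by [].
by apply/esym/eqP; rewrite eqEfcard BA cB prednK /=.
Qed.

End Grow.

Lemma connected_nb (A : cfg) a : is_connected A -> (1 < #|` A|)%N -> a \in A ->
  exists2 j, (j < 6)%N & nb a j \in A.
Proof.
move=> cA n1 aA.
have [b [c [/[!inE] /eqP -> cA' _ /adjP[j j6 e]]]] :
    exists b c, [/\ b \in [fset a]%fset, c \in A, c \notin [fset a]%fset & adj b c].
  apply: (@boundary_step A [fset a]%fset a) => //; rewrite ?fsub1set ?inE //.
  by apply: contraTneq n1 => e; rewrite -e cardfs1.
by exists j; rewrite // -e.
Qed.

Fixpoint visits (p : point) (ds : seq nat) : seq point :=
  p :: (if ds is i :: ds' then visits (nb p i) ds' else [::]).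

Lemma visits_start p ds : p \in visits p ds.
Proof. by case: ds => [|i ds]; rewrite /= !inE eqxx. Qed.

(** The walk is cut at its first visit to [b]. Since [d1] ends at [b], any continuation [d'] starts
    there, so a detour can be spliced in without disturbing the rest. *)
Lemma visits_split p ds b : b \in visits p ds ->
  exists d1 d2, ds = d1 ++ d2 /\
    (forall d', visits p (d1 ++ d') =i [predU visits p d1 & visits b d']).
Proof.
elim: ds p => [|i ds IH] p /=.
  by rewrite inE => /eqP ->; exists [::], [::]; split=> // d' x;
     rewrite !inE /=; case: eqP => // ->; rewrite visits_start.
rewrite inE => /orP[/eqP ->|/IH [d1 [d2 [-> H]]]].
  exists [::], (i :: ds); split=> // d' x; rewrite !inE /=.
  by case: eqP => // ->; rewrite visits_start.
exists (i :: d1), d2; split=> // d' x.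
by rewrite /= !inE H /= !inE orbA.
Qed.

(** A tour around a spanning tree uses each of its edges twice. Its length controls both the number
    of configurations and their diameter. *)
Lemma connected_visits (A : cfg) a : is_connected A -> a \in A ->
  exists ds, [/\ size ds = (2 * (#|` A| - 1))%N, all (fun i => i < 6)%N ds &
                 A =i visits a ds].
Proof.
move=> cA aA; pose Q (B : cfg) := exists ds,
  [/\ size ds = (2 * (#|` B| - 1))%N, all (fun i => i < 6)%N ds & B =i visits a ds].
apply: (grow_ind (Q := Q) cA aA).
  by exists [::]; split=> [||x]; rewrite ?cardfs1 ?muln0 // !inE.
move=> B b c BA bB cB bc [ds [sz alld eqB]].
have [d1 [d2 [eds H]]] : exists d1 d2, ds = d1 ++ d2 /\
    (forall d', visits a (d1 ++ d') =i [predU visits a d1 & visits b d']).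
  by apply: visits_split; rewrite -eqB.
have /adjP[i i6 ec] := bc.
(* The new particle is visited by stepping out of [b] in direction [i] and straight back in the
   opposite direction [i + 3]. *)
exists (d1 ++ i :: (i + 3) %% 6 :: d2)%N; split.
- have B0 : (0 < #|` B|)%N by rewrite cardfs_gt0; apply/fset0Pn; exists b.
  move: sz; rewrite eds !size_cat cardfsU1 cB add1n subn1 /=.
  by move: B0; case: #|` B| => [|k] //= _; rewrite subn1 /=; lia.
- by move: alld; rewrite eds !all_cat /= i6 ltn_mod.
- move=> x; rewrite H inE /= !inE eqB eds H !inE /= !nb_mod nbK -ec.
  case: (x == c); rewrite ?orbT //= .
  case: (x =P b) => [->|_]; by rewrite ?visits_start ?orbT.
Qed.

Lemma visits_near p ds x : x \in visits p ds ->
  (`|x.1 - p.1| <= (size ds)%:Z) /\ (`|x.2 - p.2| <= (size ds)%:Z).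
Proof.
elim: ds p => [|i ds IH] p /=.
  by rewrite inE => /eqP ->; rewrite !subrr.
rewrite inE => /orP[/eqP ->|/IH]; first by rewrite !subrr.
rewrite /nb -dir_mod /padd.
move: (i %% 6)%N (ltn_pmod i (isT : (0 < 6)%N)) => {}i.
by do 6?[case: i => [|i]] => //= _; lia.
Qed.

(** * Local criteria for allowed moves *)

Lemma adjP_from i v x : adj v x -> exists2 k, (k < 6)%N & x = nb v (i + k).
Proof.
(* The index [j + 5 * i] stands for [j - i] modulo 6. *)
case/adjP => j j6 ->; exists ((j + 5 * i) %% 6)%N; first by rewrite ltn_mod.
rewrite /nb -(dirM i j) -(dir_mod (i + _)) modnDmr dir_mod.
by congr (padd v (dir _)); lia.
Qed.

Lemma adj_turn v i : adj (nb v i) (nb v i.+1).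
Proof. by rewrite -(nb_turn v i) adj_nb. Qed.

Lemma nb_neq v i : nb v i != v.
Proof. by apply: contraTneq (adj_nb v i) => ->; rewrite adj_irr. Qed.

Lemma nb_inj v i j : nb v i = nb v j -> (i = j %[mod 6])%N.
Proof.
move=> /padd_inj; rewrite /dir => /(@uniqP _ (0, 0) dirs isT) ->; by rewrite // inE ltn_mod.
Qed.

Lemma adj_ring v i k : (k < 6)%N -> adj (nb v i) (nb v (i + k)) = (k == 1%N) || (k == 5%N).
Proof.
move=> k6; rewrite /nb adj_padd.
elim/dir_lt6: i => [q r|||||| ]; first by rewrite -addnA !dirM.
all: by case: k k6 => [|[|[|[|[|[|]]]]]].
Qed.

Lemma nb6 v i k : nb v (i + (6 + k)) = nb v (i + k).
Proof. by rewrite addnCA /nb -[6%N]/(1 * 6)%N dirM. Qed.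

Lemma nb_turn4 v i : nb (nb v i) (i + 4) = nb v (i + 5).
Proof.
rewrite nbD /nb; congr padd.
by elim/dir_lt6: i => // q r; rewrite -!addnA !dirM.
Qed.

Section Move.
Local Open Scope fset_scope.
Variables (A : cfg).

(** The other neighbours of [v] are confined to the three consecutive sites [j], [j + 1], [j + 2].
    Such an arc is disconnected only when both ends are occupied and the middle is empty. *)
Lemma arc3_connected v j : nb v (j + 3) \notin A -> nb v (j + 5) \notin A ->
  ~~ [&& nb v j \in A, nb v j.+1 \notin A & nb v j.+2 \in A] ->
  connectedS [set x | [/\ x \in A, adj v x & x != nb v (j + 4)]]%classic.
Proof.
move=> n3 n5 H.
have mem x : x \in A -> adj v x -> x != nb v (j + 4) ->
    [\/ x = nb v j, x = nb v j.+1 | x = nb v j.+2].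
  move=> xA /(adjP_from j)[[|[|[|[|[|[|//]]]]]] _ e x4].
  - by rewrite e addn0; constructor 1.
  - by rewrite e addn1; constructor 2.
  - by rewrite e addn2; constructor 3.
  - by rewrite e (negbTE n3) in xA.
  - by rewrite e eqxx in x4.
  - by rewrite e (negbTE n5) in xA.
have a01 := adj_turn v j; have a12 := adj_turn v j.+1.
have mid : nb v j \in A -> nb v j.+2 \in A -> nb v j.+1 \in A.
  by move=> h0 h2; move: H; rewrite h0 h2 andbT /= negbK.
have Smid : nb v j.+1 \in A -> [/\ nb v j.+1 \in A, adj v (nb v j.+1) & nb v j.+1 != nb v (j + 4)].
  move=> h; split; rewrite ?adj_nb //.
  by apply/eqP => /nb_inj /eqP; rewrite -[j.+1]addn1 eqn_modDl.
move=> a b /= [aA va a4] [bA vb b4].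
case: (mem _ aA va a4) => ea; case: (mem _ bA vb b4) => eb; subst a b.
all: try exact: lpath_refl.
all: try by apply: lpath1; rewrite // adj_sym.
all: apply: (lpath_trans (b := nb v j.+1)); apply: lpath1; rewrite //=.
all: try exact: Smid (mid _ _).
all: by rewrite adj_sym.
Qed.

Lemma deg_neq5 l i j : (i %% 6 != j %% 6)%N -> nb l i \notin A -> nb l j \notin A ->
  #|` Nb A l| <> 5%N.
Proof.
move=> ij iA jA.
pose s := [seq nb l k | k <- iota 0 6 & ((k != i %% 6) && (k != j %% 6))%N].
have sub : Nb A l `<=` [fset x in s].
  apply/fsubsetP => x; rewrite !inE /= => /andP[xA /adjP[k k6 ex]].
  apply/mapP; exists k => //; rewrite mem_filter mem_iota /= k6 andbT.
  by apply/andP; split; apply/eqP => ek; move: xA; rewrite ex ek nb_mod;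
    apply/negP.
have : (#|` Nb A l| <= 4)%N.
  apply: leq_trans (fsubset_leq_card sub) _.
  apply: leq_trans (_ : size s <= 4)%N; first by rewrite card_fseq size_undup.
  rewrite size_map /s; move: ij (ltn_pmod i (isT : (0 < 6)%N)) (ltn_pmod j (isT : (0 < 6)%N)).
  by move: (i %% 6)%N (j %% 6)%N => [|[|[|[|[|[|//]]]]]] [|[|[|[|[|[|//]]]]]].
by move=> h e; rewrite e in h.
Qed.

(** Property 2 in Boolean form. With both common neighbours empty, the eight sites around the edge
    split into two arcs of three, one at each end; each must be nonempty and free of a gap in the
    middle. *)
Lemma move_jump l i : let l' := nb l i in l \in A -> l' \notin A ->
  nb l i.+1 \notin A -> nb l (i + 5) \notin A ->
  [|| nb l (i + 2) \in A, nb l (i + 3) \in A | nb l (i + 4) \in A] ->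
  ~~ [&& nb l (i + 2) \in A, nb l (i + 3) \notin A & nb l (i + 4) \in A] ->
  [|| nb l' i.+1 \in A, nb l' i \in A | nb l' (i + 5) \in A] ->
  ~~ [&& nb l' i.+1 \in A, nb l' i \notin A & nb l' (i + 5) \in A] ->
  move_allowed A l l'.
Proof.
move=> l' lA l'A s1 s2 aN aC bN bC.
have e2 : nb l' (i + 2) = nb l i.+1 by exact: nb_turn.
have e4 : nb l' (i + 4) = nb l (i + 5) by exact: nb_turn4.
have e3 : nb l' (i + 3) = l by exact: nbK.
split=> //; first by apply: (deg_neq5 (i := i) (j := i.+1)) => //;
  rewrite -(addn1 i) -{1}(addn0 i) eqn_modDl.
right; split.
- apply/eqP; rewrite cardfs_eq0; apply/eqP/fsetP => x; rewrite !inE; apply/negbTE.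
  apply/negP => /andP[xA /andP[/(adjP_from i)[k k6 ex] l'x]].
  move: l'x xA; rewrite ex adj_ring // => /orP[] /eqP ->;
    by rewrite ?addn1 ?(negbTE s1) ?(negbTE s2).
- have : exists2 k, (1 < k < 5)%N & nb l (i + k) \in A.
    by case/or3P: aN; [exists 2%N|exists 3%N|exists 4%N].
  case=> k k15 kA; exists (nb l (i + k)); split=> //; first exact: adj_nb.
  apply/eqP => h; have /nb_inj/eqP : nb l (i + k) = nb l (i + 0) by rewrite addn0.
  by rewrite eqn_modDl; move: k15; case: k {kA h} => [|[|[|[|[|]]]]].
- have : exists2 k, k \in [:: 1; 0; 5]%N & nb l' (i + k) \in A.
    by case/or3P: bN => h; [exists 1%N|exists 0%N|exists 5%N]; rewrite ?addn0 ?addn1.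
  case=> k k15 kA; exists (nb l' (i + k)); split=> //; first exact: adj_nb.
  apply/eqP; rewrite -[X in _ = X]e3 => /nb_inj /eqP; rewrite eqn_modDl.
  by move: k15; rewrite !inE => /or3P[] /eqP ->.
- have e : nb l i = nb l (i + 2 + 4) by rewrite -addnA -[(2 + 4)%N]/(6 + 0)%N nb6 addn0.
  rewrite /l' e; apply: arc3_connected; rewrite -?addnA -?addnS //.
  by rewrite -[(2 + 5)%N]/(6 + 1)%N nb6 addn1.
- have e : l = nb l' (i + 5 + 4) by rewrite -addnA -[(5 + 4)%N]/(6 + 3)%N nb6.
  have -> : [set x | [/\ x \in A, adj l' x & x != l]]%classic =
            [set x | [/\ x \in A, adj l' x & x != nb l' (i + 5 + 4)]]%classic by rewrite -e.
  apply: arc3_connected; rewrite -?addnA -?addnS.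
  + by rewrite -[(5 + 3)%N]/(6 + 2)%N nb6 e2.
  + by rewrite -[(5 + 5)%N]/(6 + 4)%N nb6 e4.
  + have -> : nb l' (i + 6) = nb l' i by rewrite -[6%N]/(6 + 0)%N nb6 addn0.
    have -> : nb l' (i + 7) = nb l' i.+1 by rewrite -[7%N]/(6 + 1)%N nb6 addn1.
    by apply: contra bC => /and3P[-> -> ->].
Qed.

(** Property 1 in Boolean form. The eight sites around the edge form a ring in which the common
    neighbours [s1] and [s2] separate the arc [a1], [a2], [a3] at [l] from the arc [b1], [b2], [b3]
    at [l']. A particle of an arc can reach a common neighbour only along its own arc, so each
    hypothesis lists the two ways out of one site. Stated like this, moves can be checked by cases
    on occupancy bits. *)
Lemma move_slide l i : let l' := nb l i in l \in A -> l' \notin A ->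
  let s1 := nb l i.+1 \in A in let s2 := nb l (i + 5) \in A in
  let a1 := nb l (i + 2) \in A in let a2 := nb l (i + 3) \in A in let a3 := nb l (i + 4) \in A in
  let b1 := nb l' i.+1 \in A in let b2 := nb l' i \in A in let b3 := nb l' (i + 5) \in A in
  s1 || s2 -> ~~ [&& s1, a1, a2, a3 & s2] ->
  a1 ==> s1 || [&& a2, a3 & s2] -> a2 ==> (a1 && s1) || (a3 && s2) ->
  a3 ==> s2 || [&& a2, a1 & s1] ->
  b1 ==> s1 || [&& b2, b3 & s2] -> b2 ==> (b1 && s1) || (b3 && s2) ->
  b3 ==> s2 || [&& b2, b1 & s1] ->
  move_allowed A l l'.
Proof.
move=> l' lA l'A s1 s2 a1 a2 a3 b1 b2 b3 s12 Ndeg Ha1 Ha2 Ha3 Hb1 Hb2 Hb3.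
have e2 : nb l' (i + 2) = nb l i.+1 by exact: nb_turn.
have e4 : nb l' (i + 4) = nb l (i + 5) by exact: nb_turn4.
have e3 : nb l' (i + 3) = l by exact: nbK.
split=> //.
  have far k : (0 < k < 6)%N -> nb l (i + k) \notin A -> #|` Nb A l| <> 5%N.
    move=> k06 kA; apply: (deg_neq5 (i := i) (j := (i + k)%N)) => //.
    by rewrite -{1}(addn0 i) eqn_modDl; move: k06; case: k {kA} => [|[|[|[|[|[|]]]]]].
  by move: Ndeg; rewrite !negb_and => /or4P[||| /orP[]];
    [rewrite /s1 -addn1| | | | ]; exact: far.
left; rewrite /property1 /=; set S := (X in (#|` X| = 1%N \/ _) /\ _); set Nu := (X in _ /\ forall x, x \in X -> _).
have Ssub x : x \in S -> x = nb l i.+1 \/ x = nb l (i + 5).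
  rewrite !inE /= => /andP[xA /andP[/(adjP_from i)[k k6 ex]]].
  by rewrite ex adj_ring // => /orP[] /eqP ->; [left; rewrite addn1|right].
have S1 : s1 -> nb l i.+1 \in S.
  by move=> h; rewrite !inE /= /s1 in h *; rewrite h adj_nb -e2 adj_nb.
have S2 : s2 -> nb l (i + 5) \in S.
  by move=> h; rewrite !inE /= /s2 in h *; rewrite h adj_nb -e4 adj_nb.
split.
  have : (0 < #|` S| <= 2)%N.
    apply/andP; split.
      by rewrite cardfs_gt0; apply/fset0Pn; case/orP: s12 => h; [exists (nb l i.+1); auto|exists (nb l (i + 5)); auto].
    apply: (leq_trans (n := #|` [fset nb l i.+1; nb l (i + 5)]|)).
      apply: fsubset_leq_card; apply/fsubsetP => x /Ssub[] ->; rewrite !inE eqxx ?orbT //.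
    by rewrite cardfs2; case: eqP.
  by case: #|` S| => [|[|[|]]] //; [left|right].
have ina k : (0 < k < 6)%N -> nb l (i + k) \in A -> occ Nu (nb l (i + k)).
  move=> k06 kA; rewrite /occ /= !inE /= kA adj_nb /= nb_neq /=.
  by apply: contraNneq l'A => <-.
have inb k : k \in [:: 0; 1; 2; 4; 5]%N -> nb l' (i + k) \in A -> occ Nu (nb l' (i + k)).
  move=> k06 kA; rewrite /occ /= !inE /= kA adj_nb orbT nb_neq andbT /=.
  rewrite -[X in _ != X]e3; apply/eqP => /nb_inj/eqP; rewrite eqn_modDl.
  by move: k06; rewrite !inE => /or4P[||| /orP[]] /eqP ->.
have E0 : nb l' i = nb l' (i + 0) by rewrite addn0.
have E1 w : nb w i.+1 = nb w (i + 1) by rewrite addn1.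
have E6 : nb l' (i + 0) = nb l' (i + 6) by rewrite -[6%N]/(6 + 0)%N nb6.
have up v k : adj (nb v (i + k)) (nb v (i + k.+1)) by rewrite addnS adj_turn.
have dn v k : adj (nb v (i + k.+1)) (nb v (i + k)) by rewrite adj_sym up.
have up6 : adj (nb l' (i + 5)) (nb l' (i + 0)) by rewrite E6 up.
have dn6 : adj (nb l' (i + 0)) (nb l' (i + 5)) by rewrite adj_sym up6.
rewrite -/l' in S1 S2.
have T1 : s1 -> nb l (i + 1) \in S by rewrite addn1.
have step2 x y t : adj x y -> occ Nu y -> adj y t -> occ Nu t -> lpath (occ Nu) x t.
  by move=> xy Ny yt Nt; apply: (lpath_trans (lpath1 xy Ny)); apply: lpath1.
have step3 x y z t : adj x y -> occ Nu y -> adj y z -> occ Nu z -> adj z t -> occ Nu t ->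
    lpath (occ Nu) x t.
  by move=> xy Ny yz Nz zt Nt; apply: (lpath_trans (lpath1 xy Ny)); apply: step2 Nz _ Nt.
rewrite /s1 /s2 /a1 /a2 /a3 /b1 /b2 /b3 in S1 S2 T1 Ha1 Ha2 Ha3 Hb1 Hb2 Hb3.
rewrite ?E0 ?E1 ?E1 in e2 e4 S1 Ha1 Ha2 Ha3 Hb1 Hb2 Hb3.
have Nuin x : x \in Nu -> [/\ x \in A, adj l x || adj l' x, x != l & x != l'].
  by rewrite !inE => /andP[xA /andP[/andP[adjx xl] xl']].
have Sin x : x \in A -> adj l x -> adj l' x -> x \in S.
  by move=> xA lx l'x; rewrite !inE /= xA lx l'x.
have reach x : x \in Nu -> [\/ x \in S,
   exists2 k, (1 < k < 5)%N & x = nb l (i + k) | exists2 k, k \in [:: 0; 1; 5]%N & x = nb l' (i + k)].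
  move=> /Nuin[xA adjx xl xl'].
  have [/(adjP_from i)[k k6 ex]|nlx] := boolP (adj l x).
    move: k k6 ex => [|[|[|[|[|[|//]]]]]] _ ex.
    - by rewrite ex addn0 eqxx in xl'.
    - by constructor 1; apply: Sin; rewrite // ex ?adj_nb // -e2 adj_nb.
    - by constructor 2; exists 2%N.
    - by constructor 2; exists 3%N.
    - by constructor 2; exists 4%N.
    - by constructor 1; apply: Sin; rewrite // ex ?adj_nb // -e4 adj_nb.
  move: adjx; rewrite (negbTE nlx) /= => /(adjP_from i)[[|[|[|[|[|[|//]]]]]] _ ex].
  - by constructor 3; exists 0%N.
  - by constructor 3; exists 1%N.
  - by rewrite ex e2 adj_nb in nlx.
  - by rewrite ex e3 eqxx in xl.
  - by rewrite ex e4 adj_nb in nlx.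
  - by constructor 3; exists 5%N.
move=> x xN; have xA : x \in A by move: xN; rewrite !inE => /andP[].
case: (reach x xN) => [xS|[k k15 ex]|[k k015 ex]].
- by exists x => //; apply: lpath_refl.
- rewrite ex in xA *.
  move: k k15 {ex} xA => [|[|[|[|[|//]]]]] // _ xA.
  + move: Ha1; rewrite xA => /orP[h1|/and3P[h1 h2 h3]].
      by exists (nb l (i + 1)); [auto|apply: lpath1; [exact: dn|exact: ina]].
    exists (nb l (i + 5)); first by auto.
    by apply: step3 (up _ _) (ina _ _ h1) (up _ _) (ina _ _ h2) (up _ _) (ina _ _ h3).
  + move: Ha2; rewrite xA => /orP[/andP[h1 h2]|/andP[h1 h2]].
      exists (nb l (i + 1)); first by auto.
      by apply: step2 (dn _ _) (ina _ _ h1) (dn _ _) (ina _ _ h2).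
    exists (nb l (i + 5)); first by auto.
    by apply: step2 (up _ _) (ina _ _ h1) (up _ _) (ina _ _ h2).
  + move: Ha3; rewrite xA => /orP[h1|/and3P[h1 h2 h3]].
      by exists (nb l (i + 5)); [auto|apply: lpath1; [exact: up|exact: ina]].
    exists (nb l (i + 1)); first by auto.
    by apply: step3 (dn _ _) (ina _ _ h1) (dn _ _) (ina _ _ h2) (dn _ _) (ina _ _ h3).
- rewrite ex in xA *; rewrite -e2 -e4 in Hb1 Hb2 Hb3 S1 S2 T1.
  move: k015 {ex} xA; rewrite !inE => /or3P[] /eqP -> xA.
  + move: Hb2; rewrite xA => /orP[/andP[h1 h2]|/andP[h1 h2]].
      exists (nb l' (i + 2)); first by auto.
      by apply: step2 (up _ _) (inb _ _ h1) (up _ _) (inb _ _ h2).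
    exists (nb l' (i + 4)); first by auto.
    by apply: step2 dn6 (inb _ _ h1) (dn _ _) (inb _ _ h2).
  + move: Hb1; rewrite xA => /orP[h1|/and3P[h1 h2 h3]].
      by exists (nb l' (i + 2)); [auto|apply: lpath1; [exact: up|exact: inb]].
    exists (nb l' (i + 4)); first by auto.
    by apply: step3 (dn _ _) (inb _ _ h1) dn6 (inb _ _ h2) (dn _ _) (inb _ _ h3).
  + move: Hb3; rewrite xA => /orP[h1|/and3P[h1 h2 h3]].
      by exists (nb l' (i + 4)); [auto|apply: lpath1; [exact: dn|exact: inb]].
    exists (nb l' (i + 2)); first by auto.
    by apply: step3 up6 (inb _ _ h1) (up _ _) (inb _ _ h2) (up _ _) (inb _ _ h3).
Qed.
End Move.

(** * Reaching a configuration without triangles *)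

(* Offsets of iterated neighbours are evaluated, so that equal sites become
   syntactically equal and occupancy patterns can be checked by cases. *)
Ltac offsets :=
  rewrite /nb ?paddA;
  repeat match goal with
  | |- context [padd (dir ?i) (padd (dir ?j) (dir ?k))] =>
      let t := constr:(padd (dir i) (padd (dir j) (dir k))) in
      let v := eval vm_compute in t in change t with v
  | |- context [padd (dir ?i) (dir ?j)] =>
      let t := constr:(padd (dir i) (dir j)) in
      let v := eval vm_compute in t in change t with v
  | |- context [dir ?i] =>
      let t := constr:(dir i) in
      let v := eval vm_compute in t in change t with v
  end.
Ltac bits A := offsets; do 14?[case: (_ \in A) => //=].

(** Only [d = 0] and [d = 5] occur, the two directions that lead to the next column; every nonzero
    [d] is read as direction 5, along which the sum of the coordinates is constant. *)
Definition ray (d : nat) (q x : point) : bool :=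
  (q.1 <= x.1) && (if d is 0%N then x.2 == q.2 else x.1 + x.2 == q.1 + q.2).

Lemma ray_padd d q u v : ray d (padd q u) (padd q v) = ray d u v.
Proof.
case: q u v => [x y] [a b] [a' b']; rewrite /ray /padd /=.
by rewrite lerD2l; congr (_ && _); case: d => [|d]; lia.
Qed.

Lemma ray_padd0 d q v : ray d q (padd q v) = ray d (0, 0) v.
Proof. by rewrite -{1}[q]paddr0 ray_padd. Qed.

Lemma ray_trans d q q' x : ray d q q' -> ray d q' x -> ray d q x.
Proof.
rewrite /ray => /andP[h1 h2] /andP[h3 h4]; rewrite (le_trans h1 h3) /=.
by case: d h2 h4 => [|d] /eqP <- /eqP ->.
Qed.

Ltac rays := offsets; rewrite ?ray_padd ?ray_padd0 //.

Section Reach.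
Local Open Scope fset_scope.
Local Open Scope ring_scope.

Lemma in_moved A l l' x : (x \in moved A l l') = (x == l') || ((x != l) && (x \in A)).
Proof. by rewrite !inE. Qed.

Variable U : cfg -> Prop.
Hypothesis Umove : forall A l i, U A -> l \in A -> move_allowed A l (nb l i) ->
  U (moved A l (nb l i)).
Hypothesis Unb : forall A a, U A -> a \in A -> exists2 j, (j < 6)%N & nb a j \in A.

(* The site w = nb q d pinches off a pocket behind q. Either q gets filled, or w
   moves out of the way; only sites on the ray from q are affected. *)
Lemma chain d k A (q : point) : d = 0%N \/ d = 5%N -> U A ->
  (forall x, x \in A -> x.1 < q.1 + k%:Z) ->
  q \notin A -> nb q (d + 1) \notin A -> nb q (d + 5) \notin A -> nb q d \in A ->
  [|| nb q (d + 2) \in A, nb q (d + 3) \in A | nb q (d + 4) \in A] ->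
  ~~ [&& nb q (d + 2) \in A, nb q (d + 3) \notin A & nb q (d + 4) \in A] ->
  exists A' : cfg, [/\ U A', forall x, ~~ ray d q x -> (x \in A') = (x \in A) &
    q \in A' \/ (q \notin A' /\ nb q d \notin A')].
Proof.
move=> d05; elim/ltn_ind: k A q => k IH A q UA bnd qA q1 q5 wA qN qC.
pose w := nb q d.
have [j j6 wj] := Unb UA wA.
have jump B : U B -> q \notin B -> w \in B ->
    [/\ nb q (d + 1) \notin B & nb q (d + 5) \notin B] ->
    [|| nb w d.+1 \in B, nb w d \in B | nb w (d + 5) \in B] ->
    ~~ [&& nb w d.+1 \in B, nb w d \notin B & nb w (d + 5) \in B] ->
    [|| nb q (d + 2) \in B, nb q (d + 3) \in B | nb q (d + 4) \in B] ->
    ~~ [&& nb q (d + 2) \in B, nb q (d + 3) \notin B & nb q (d + 4) \in B] ->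
    U (moved B w q).
  move=> UB qB wB [n1 n5] wN wC bN bC.
  have e : nb w (d + 3) = q by exact: nbK.
  rewrite -e; apply: Umove => //; apply: move_jump; rewrite ?e //;
    move: n1 n5 wN wC bN bC; rewrite /w; case: d05 => ->; by bits B.
have flip B : U B -> w \in B -> nb w d \notin B -> 
    [/\ q \notin B, nb q (d + 1) \notin B & nb q (d + 5) \notin B] ->
    nb w d.+1 \in B -> nb w (d + 5) \in B ->
    ~~ [&& nb (nb w d) d.+1 \notin B, nb (nb w d) d \in B & nb (nb w d) (d + 5) \notin B] ->
    U (moved B w (nb w d)).
  move=> UB wB wd [qB n1 n5] w1 w5 ok.
  have qB' : padd q (0, 0) \notin B by rewrite paddr0.
  apply: Umove => //; apply: move_slide => //;
    move: qB' wd n1 n5 w1 w5 ok; rewrite /w; case: d05 => ->; by bits B.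
have rq : ray d q q by rewrite -[q]paddr0 ray_padd; case: d05 => ->.
have nb1 x : (nb x d).1 = x.1 + 1 by case: d05 => ->.
have rw : ray d q w by rewrite /w; case: d05 => ->; rays.
have rw' : ray d q (nb w d) by rewrite /w; case: d05 => ->; rays.
have off x : ~~ ray d q x -> [/\ x != q, x != w & x != nb w d].
  by move=> nx; split; apply: contraNneq nx => ->.
have qw : q != w by rewrite eq_sym nb_neq.
(* The three sites of [w] facing [q] are empty, so the neighbour that [w] must have lies ahead of
   it. *)
have wN : [|| nb w d.+1 \in A, nb w d \in A | nb w (d + 5) \in A].
  move: wj qA q1 q5; rewrite -{2}[q]paddr0 /w; clear - d05 j6.
  by case: d05 => ->; move: j j6 => [|[|[|[|[|[|//]]]]]] _; bits A.
have [wC|/negPn/and3P[h1 h2 h3]] :=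
    boolP (~~ [&& nb w d.+1 \in A, nb w d \notin A & nb w (d + 5) \in A]).
  exists (moved A w q); split; first exact: jump.
    by move=> x /off[xq xw _]; rewrite in_moved (negbTE xq) xw.
  by left; rewrite in_moved eqxx.
have flipped B : U B -> (forall x, ~~ ray d q x -> (x \in B) = (x \in A)) -> q \notin B ->
    U (moved B w (nb w d)) -> exists A' : cfg, [/\ U A', forall x, ~~ ray d q x -> (x \in A') = (x \in A) &
    q \in A' \/ (q \notin A' /\ nb q d \notin A')].
  move=> UB BA qB UB'; exists (moved B w (nb w d)); split=> //.
    by move=> x nx; have [xq xw xw'] := off x nx; rewrite in_moved (negbTE xw') xw BA.
  have qw' : q != nb w d by rewrite /w; case: d05 => ->; rewrite -{1}[q]paddr0; offsets; apply/eqP => /padd_inj.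
  right; rewrite !in_moved (negbTE qw') (negbTE qB) andbF; split=> //.
  by rewrite -/w eqxx /= orbF eq_sym nb_neq.
have [ok|/negPn/and3P[q'1 q'0 q'5]] := boolP (~~ [&& nb (nb w d) d.+1 \notin A,
    nb (nb w d) d \in A & nb (nb w d) (d + 5) \notin A]).
  by apply: (flipped A) => //; apply: flip.
(* The repeated obstruction has a particle three columns beyond [q]; hence [k - 2] is a true
   subtraction and bounds the configuration as seen from [nb w d], two columns further. *)
have k2 : (2 < k)%N.
  have := bnd _ q'0; rewrite /w !nb1; clear; lia.
have w'A : nb w d \notin A by [].
have [A2 [UA2 A2A A2q]] : exists A2 : cfg, [/\ U A2,
    forall x, ~~ ray d (nb w d) x -> (x \in A2) = (x \in A) &
    nb w d \in A2 \/ (nb w d \notin A2 /\ nb (nb w d) d \notin A2)].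
  apply: (IH (k - 2)%N) => //.
  - by rewrite ltn_subrL (ltn_trans _ k2).
  - by move=> x /bnd; rewrite /w !nb1; clear - k2; lia.
  - by rewrite addn1.
  - by move: h1 wA h3; rewrite /w; case: d05 => ->; bits A.
  - by move: h1 wA h3; rewrite /w; case: d05 => ->; bits A.
have tr x : ~~ ray d (nb w d) x -> (x \in A2) = (x \in A) by exact: A2A.
have A2A' x : ~~ ray d q x -> (x \in A2) = (x \in A).
  by move=> nx; apply: tr; apply: contra nx; apply: ray_trans.
have wA2 : w \in A2 by rewrite tr // /w; case: d05 => ->; rays.
have qA2 : q \notin A2 by rewrite tr // /w -[X in ray _ _ X]paddr0; case: d05 => ->; rays.
have n1 : nb q (d + 1) \notin A2 by rewrite tr // /w; case: d05 => ->; rays.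
have n5 : nb q (d + 5) \notin A2 by rewrite tr // /w; case: d05 => ->; rays.
have n2 : (nb q (d + 2) \in A2) = (nb q (d + 2) \in A) by rewrite tr // /w; case: d05 => ->; rays.
have n3 : (nb q (d + 3) \in A2) = (nb q (d + 3) \in A) by rewrite tr // /w; case: d05 => ->; rays.
have n4 : (nb q (d + 4) \in A2) = (nb q (d + 4) \in A) by rewrite tr // /w; case: d05 => ->; rays.
have m1 : nb w d.+1 \in A2 by rewrite tr // /w; case: d05 => ->; rays.
have m5 : nb w (d + 5) \in A2 by rewrite tr // /w; case: d05 => ->; rays.
(* If the site ahead of [w] was filled, the gap in the bend is closed and [w] can jump into [q]. If
   that site and the next one are empty, nothing blocks flipping [w] any more. *)
case: A2q => [w'A2|[w'A2 w''A2]].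
  exists (moved A2 w q); split; last by left; rewrite in_moved eqxx.
    by apply: jump; rewrite ?n2 ?n3 ?n4 // ?m1 ?w'A2 //= andbF.
  by move=> x nx; have [xq xw _] := off x nx; rewrite in_moved (negbTE xq) xw A2A'.
apply: (flipped A2) => //; apply: flip => //.
by rewrite (negbTE w''A2) andbF.
Qed.
End Reach.

(** * Removing the top particle of a column *)

Section Column.
Local Open Scope fset_scope.
Local Open Scope ring_scope.
Variable U : cfg -> Prop.
Hypothesis Umove : forall A l i, U A -> l \in A -> move_allowed A l (nb l i) ->
  U (moved A l (nb l i)).
Hypothesis Unb : forall A a, U A -> a \in A -> exists2 j, (j < 6)%N & nb a j \in A.
Variable H : nat.
Hypothesis Uheight : forall A x y, U A -> x \in A -> y \in A -> x.2 - y.2 <= H%:Z.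

Lemma fset_bound (A : cfg) (q : point) : exists k : nat, forall x, x \in A -> x.1 < q.1 + k%:Z.
Proof.
exists (\sum_(x <- A) `|x.1 - q.1|%N).+1 => x xA.
rewrite (big_rem x) //=; clear; set s := (\sum_(_ <- _) _)%N; lia.
Qed.

(** [P] either enters column [c + 1] or climbs one site and tries again. Each climb increases
    [P.2 - Q.2], which [H] bounds, so [k] cannot run out. The bound on column [c - 1] keeps the left
    side of the climb empty. The last hypothesis ensures that a left neighbour [nb P 3] is not cut
    off when [P] leaves, being linked through [nb P 4]; after a climb it is vacuous, since the new
    site [nb P 3] is the old, empty [nb P 2]. *)
Lemma top_reduce k (c : int) A (P Q : point) : U A -> P \in A -> P.1 = c ->
  (forall x, x \in A -> x.1 = c -> x.2 <= P.2) ->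
  Q \in A -> Q.1 = c -> Q <> P -> H%:Z - (P.2 - Q.2) < k%:Z ->
  (forall x, x \in A -> x.1 = c - 1 -> x.2 <= P.2) ->
  (nb P 3 \in A -> nb P 4 \in A) ->
  exists A' : cfg, [/\ U A', forall x : point, x.1 < c -> (x \in A') = (x \in A) &
    forall x : point, x.1 = c -> (x \in A') = (x != P) && (x \in A)].
Proof.
elim: k A P => [|k IH] A P UA PA Pc top QA Qc QP hk left tail.
  by move: hk; rewrite ltNge subr_ge0 (Uheight UA PA QA).
have c1 x : x.1 = c -> (nb x 1).1 = c by move=> <-; rewrite /nb /padd /= addr0.
have c2 : (nb P 2).1 = c - 1 by rewrite -Pc.
have P1 : nb P 1 \notin A.
  by apply/negP => /top -/(_ (c1 _ Pc)); rewrite /= -subr_ge0 opprD addNKr.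
have P11 : nb (nb P 1) 1 \notin A.
  apply/negP => /top -/(_ (c1 _ (c1 _ Pc))); rewrite /=; clear; lia.
have P2 : nb P 2 \notin A.
  by apply/negP => /left -/(_ c2) /=; clear; lia.
have P12 : nb (nb P 1) 2 \notin A.
  have e : (nb (nb P 1) 2).1 = c - 1 by rewrite -Pc /= addr0.
  by apply/negP => /left -/(_ e) /=; clear; lia.
(* [chain] changes only a ray that starts in column [c + 1], so all intermediate configurations
   agree with [A] up to column [c], and the local facts around [P] survive. *)
pose agree (B : cfg) := forall x : point, x.1 <= c -> (x \in B) = (x \in A).
pose goal := exists A' : cfg, [/\ U A', forall x : point, x.1 < c -> (x \in A') = (x \in A) &
    forall x : point, x.1 = c -> (x \in A') = (x != P) && (x \in A)].
have facts B : agree B -> [&& padd P (0, 0) \in B, nb P 1 \notin B, nb P 2 \notin B,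
   nb (nb P 1) 1 \notin B, nb (nb P 1) 2 \notin B & (nb P 3 \in B) ==> (nb P 4 \in B)].
  move=> ag; rewrite paddr0 !ag ?PA ?P1 ?P11 ?P2 ?P12 /= ?Pc ?addr0; try by clear; lia.
  exact/implyP.
have enter B i : i = 0%N \/ i = 5%N -> U B -> agree B -> move_allowed B P (nb P i) -> goal.
  move=> i05 UB ag ok; exists (moved B P (nb P i)).
  have ei : (nb P i).1 = c + 1 by rewrite -Pc; case: i05 => ->.
  have PB : P \in B by have /andP[] := facts B ag; rewrite paddr0.
  split; first exact: Umove.
  - move=> x xc; rewrite in_moved ag ?ltW //.
    have -> : (x == nb P i) = false by apply/eqP => e; move: xc; rewrite e ei; clear; lia.
    have -> // : (x != P) by apply/eqP => e; move: xc; rewrite e Pc; clear; lia.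
  - move=> x xc; rewrite in_moved ag ?xc //.
    by have -> : (x == nb P i) = false by apply/eqP => e; move: xc; rewrite e ei; clear; lia.
have up B : U B -> agree B -> move_allowed B P (nb P 1) -> goal.
  move=> UB ag ok; have := facts B ag; rewrite paddr0 => /and5P[PB B1 B2 B11 /andP[B12 B3]].
  have [A' [UA' lA' cA']] : exists A' : cfg, [/\ U A',
     forall x : point, x.1 < c -> (x \in A') = (x \in moved B P (nb P 1)) &
     forall x : point, x.1 = c -> (x \in A') = (x != nb P 1) && (x \in moved B P (nb P 1))].
    apply: IH; first exact: Umove.
    - by rewrite in_moved eqxx.
    - exact: c1.
    - move=> x; rewrite in_moved => /orP[/eqP -> //|/andP[_ xB]] xc.
      have := top x; rewrite -ag ?xc // xB => /(_ isT erefl) /=; clear; lia.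
    - by rewrite in_moved ag ?Qc // QA andbT; apply/orP; right; apply/eqP.
    - by [].
    - by move=> e; move: P1; rewrite -e QA.
    - by move: hk; rewrite /=; clear; lia.
    - move=> x; rewrite in_moved => /orP[/eqP -> //|/andP[_ xB]] xc.
      have := left x; rewrite -ag ?xc ?gerBl // xB => /(_ isT erefl) /=; clear; lia.
    - have -> : nb (nb P 1) 3 = nb P 2 by rewrite -(nb_turn P 1).
      rewrite in_moved (negbTE B2) andbF orbF => /eqP e.
      by move: c2 (c1 _ Pc); rewrite e; clear; lia.
  exists A'; split=> // x xc.
    rewrite lA' // in_moved ag ?ltW //.
    have -> : (x == nb P 1) = false by apply/eqP => e; move: xc; rewrite e (c1 _ Pc) ltxx.
    by have -> : (x != P) by apply/eqP => e; move: xc; rewrite e Pc ltxx.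
  rewrite cA' // in_moved ag ?xc //.
  by case: (x =P nb P 1) => [->|_] //=; rewrite (negbTE P1) andbF.
(* With [nb P 0] occupied, climbing is a slide along it: this particle is adjacent to both [P] and
   [nb P 1], and the lower neighbours of [P] hang on to it through [nb P 5]. *)
have b1 B : U B -> agree B -> nb P 0 \in B -> (nb P 4 \in B) ==> (nb P 5 \in B) -> goal.
  move=> UB ag h0 h45; have F := facts B ag; have /andP[PB _] := F; rewrite paddr0 in PB.
  apply: (up B) => //; apply: move_slide => //; move: F h0 h45; by bits B.
have chase d q B : d = 0%N \/ d = 5%N -> q.1 = c + 1 -> U B -> agree B -> q \notin B ->
    nb q (d + 1) \notin B -> nb q (d + 5) \notin B -> nb q d \in B ->
    [|| nb q (d + 2) \in B, nb q (d + 3) \in B | nb q (d + 4) \in B] ->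
    ~~ [&& nb q (d + 2) \in B, nb q (d + 3) \notin B & nb q (d + 4) \in B] ->
    exists B', [/\ U B', agree B', forall x, ~~ ray d q x -> (x \in B') = (x \in B) &
      q \in B' \/ (q \notin B' /\ nb q d \notin B')].
  move=> d05 qc UB ag qB q1 q5 q0 qN qC; have [m bm] := fset_bound B q.
  have [B' [UB' B'B qB']] := chain Umove Unb d05 UB bm qB q1 q5 q0 qN qC.
  exists B'; split=> // x xc; rewrite B'B ?ag // /ray qc.
  by apply/negP => /andP[h _]; move: (le_trans h xc); clear; lia.
have P0c : (nb P 0).1 = c + 1 by rewrite -Pc.
have P5c : (nb P 5).1 = c + 1 by rewrite -Pc.
have b2 B : U B -> agree B -> nb P 0 \notin B -> nb P 5 \in B -> goal.
  move=> UB ag h0 h5; have F := facts B ag; have /andP[PB _] := F; rewrite paddr0 in PB.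
  have [q1|q1] := boolP (nb (nb P 0) 1 \in B).
    by apply: (up B) => //; apply: move_jump => //; move: F h0 h5 q1; bits B.
  have [q05|q05] := boolP ((nb (nb P 0) 0 \in B) && (nb (nb P 0) 5 \notin B)).
    have [|||||B' [UB' ag' B'B qB']] := chase 0%N (nb P 0) B (or_introl erefl) P0c UB ag h0.
    1-5: by move: F h0 h5 q1 q05; bits B.
    have n1 : nb (nb P 0) 1 \notin B' by rewrite B'B //; rays.
    have n5 : nb (nb P 0) 5 \notin B'.
      by rewrite B'B; [have /andP[] := q05|rays].
    have m5 : nb P 5 \in B' by rewrite B'B //; rays.
    case: qB' => [q0|[q0 q00]]; first by apply: (b1 B'); rewrite // m5 implybT.
    have F' := facts B' ag'; have /andP[PB' _] := F'; rewrite paddr0 in PB'.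
    apply: (enter B' 0%N) => //; first by left.
    by apply: move_slide => //; move: F' q0 q00 n1 n5 m5; bits B'.
  apply: (enter B 0%N) => //; first by left.
  by apply: move_slide => //; move: F q1 q05 h0 h5; bits B.
have agA : agree A by [].
have F := facts A agA.
have [h5|h5] := boolP (nb P 5 \in A).
  have [h0|h0] := boolP (nb P 0 \in A); last exact: (b2 A).
  by apply: (b1 A); rewrite // h5 implybT.
have P4 : (nb P 4 \in A) || (nb P 0 \in A).
  have [j j6 Pj] := Unb UA PA.
  by move: j j6 Pj F h5 => [|[|[|[|[|[|//]]]]]] _; bits A.
(* A lone particle beyond [nb P 5] blocks the slide into that site. After [chain], either the
   blocking particle is gone and [P] slides in, or [nb P 5] is filled and the continuation [fill]
   takes over. *)
have chase5 : nb (nb P 5) 5 \in A -> nb (nb P 5) 4 \notin A -> nb (nb P 5) 0 \notin A ->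
    nb P 4 \in A ->
    (forall B, U B -> agree B -> (nb P 0 \in B) = (nb P 0 \in A) -> nb P 4 \in B ->
       nb P 5 \in B -> goal) -> goal.
  move=> q5 q4 q0 h4 fill.
  have [|||||B' [UB' ag' B'B qB']] := chase 5%N (nb P 5) A (or_intror erefl) P5c UA agA h5.
  1-5: by move: F h5 q5 q4 q0 h4; bits A.
  have m0 : (nb P 0 \in B') = (nb P 0 \in A) by rewrite B'B //; rays.
  have m4 : nb P 4 \in B' by rewrite ag' // /= Pc addr0.
  case: qB' => [q|[q q55]]; first exact: (fill B').
  have n4 : nb (nb P 5) 4 \notin B' by rewrite B'B //; rays.
  have n0 : nb (nb P 5) 0 \notin B' by rewrite B'B //; rays.
  have F' := facts B' ag'; have /andP[PB' _] := F'; rewrite paddr0 in PB'.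
  apply: (enter B' 5%N) => //; first by right.
  by apply: move_slide => //; move: F' q q55 n4 n0 m4; bits B'.
have [h0|h0] := boolP (nb P 0 \in A).
  have [h4|h4] := boolP (nb P 4 \in A); last by apply: (b1 A); rewrite // (negbTE h4).
  have [/and3P[q5 q4 q0]|q] := boolP [&& nb (nb P 5) 5 \in A, nb (nb P 5) 4 \notin A
                                     & nb (nb P 5) 0 \notin A].
    by apply: chase5 => // B UB ag m0 m4 m5; apply: (b1 B); rewrite // ?m0 // m5 implybT.
  apply: (enter A 5%N) => //; first by right.
  by apply: move_slide => //; move: F h5 h0 h4 q; bits A.
have h4 : nb P 4 \in A by case/orP: P4 => // h; rewrite h in h0.
have [q0|q0] := boolP (nb (nb P 5) 0 \in A).
  have [r|r] := boolP ((nb (nb P 0) 1 \in A) && (nb (nb P 0) 0 \notin A)).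
    by apply: (up A) => //; apply: move_jump => //; move: F h5 h4 h0 q0 r; bits A.
  apply: (enter A 0%N) => //; first by left.
  by apply: move_jump => //; move: F h5 h4 h0 q0 r; bits A.
have [/andP[q5 q4]|q] := boolP ((nb (nb P 5) 5 \in A) && (nb (nb P 5) 4 \notin A)).
  by apply: chase5 => // B UB ag m0 m4 m5; apply: (b2 B); rewrite // m0.
apply: (enter A 5%N) => //; first by right.
by apply: move_slide => //; move: F h5 h0 h4 q0 q; bits A.
Qed.
End Column.

(** * Transport of configurations and moves along lattice symmetries *)

Section Image.
Local Open Scope fset_scope.
Variable g : point -> point.
Hypothesis g_inj : injective g.
Hypothesis g_adj : forall a b, adj (g a) (g b) = adj a b.
Definition gset (A : cfg) : cfg := [fset g x | x in A].

Lemma mem_gset A x : (g x \in gset A) = (x \in A).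
Proof. by rewrite (mem_imfset _ _ g_inj). Qed.

Lemma gsetP A y : reflect (exists2 x, x \in A & y = g x) (y \in gset A).
Proof. exact: imfsetP. Qed.

Lemma card_gset A : #|` gset A| = #|` A|.
Proof. exact: card_imfset. Qed.

Lemma gset_moved A l l' : gset (moved A l l') = moved (gset A) (g l) (g l').
Proof.
apply/fsetP => y; rewrite in_moved; apply/gsetP/orP => [[x]|].
  rewrite in_moved => /orP[/eqP -> ->|/andP[xl xA] ->]; first by left.
  by right; rewrite mem_gset xA andbT (inj_eq g_inj).
case=> [/eqP ->|/andP[yl /gsetP[x xA e]]]; first by exists l'; rewrite // in_moved eqxx.
exists x => //; rewrite in_moved xA andbT; apply/orP; right.
by apply: contra yl => /eqP <-; rewrite e.
Qed.

Lemma lpath_gset (S S' : set point) a b : (forall x, S x -> S' (g x)) ->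
  lpath S a b -> lpath S' (g a) (g b).
Proof.
move=> SS' [s [ps ls Ss]]; exists (map g s); split.
- by rewrite path_map; apply: sub_path ps => x y; rewrite /relpre /= g_adj.
- by rewrite last_map ls.
- by move=> _ /mapP[x xs ->]; exact/SS'/Ss.
Qed.

Lemma gset_filter A (p q : pred point) : (forall x, q (g x) = p x) ->
  [fset y in gset A | q y] = gset [fset x in A | p x].
Proof.
move=> qp; apply/fsetP => y; apply/idP/gsetP => [|[x + ->]].
  rewrite !inE => /andP[/gsetP[x xA ->] qy].
  by exists x; rewrite // !inE xA -qp.
by rewrite !inE => /andP[xA px]; rewrite mem_gset xA qp.
Qed.

Lemma connectedS_gset (A : cfg) (Q Q' : set point) : (forall x, Q' (g x) <-> Q x) ->
  connectedS [set x | x \in A /\ Q x]%classic ->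
  connectedS [set y | y \in gset A /\ Q' y]%classic.
Proof.
move=> QQ' cQ _ _ [/= /gsetP[a aA ->] /QQ' Qa] [/= /gsetP[b bA ->] /QQ' Qb].
have := cQ a b; rewrite /= => /(_ (conj aA Qa) (conj bA Qb)).
by apply: lpath_gset => x [xA Qx]; rewrite /= mem_gset; split=> //; exact/QQ'.
Qed.

Lemma gset_connected A : is_connected A -> is_connected (gset A).
Proof.
move=> cA _ _ /gsetP[a aA ->] /gsetP[b bA ->].
by apply: lpath_gset (cA _ _ aA bA) => x xA; rewrite /occ /= mem_gset.
Qed.

Lemma gset_move A l l' : move_allowed A l l' -> move_allowed (gset A) (g l) (g l').
Proof.
have neq x y : (g x != g y) = (x != y) by rewrite (inj_eq g_inj).
move=> [l'A d5 pr]; split; first by rewrite mem_gset.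
  by rewrite /Nb (@gset_filter A (adj l)) ?card_gset.
case: pr => [[S12 Nu]|[S0 [x [xA lx xl']] [y [yA l'y yl]] c c']]; [left|right].
  have eS : [fset x in gset A | adj (g l) x && adj (g l') x] =
            gset [fset x in A | adj l x && adj l' x].
    by apply: gset_filter => x; rewrite !g_adj.
  have eN : [fset x in gset A | (adj (g l) x || adj (g l') x) && (x != g l) && (x != g l')] =
            gset [fset x in A | (adj l x || adj l' x) && (x != l) && (x != l')].
    by apply: gset_filter => x; rewrite !g_adj !neq.
  rewrite /property1 eS eN card_gset; split=> // _ /gsetP[x xN ->].
  have [y yS xy] := Nu x xN; exists (g y); first by rewrite mem_gset.
  by apply: lpath_gset xy => z zN; rewrite /occ /= mem_gset.
split.
- rewrite (@gset_filter A (fun x => adj l x && adj l' x)) ?card_gset // => z.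
  by rewrite !g_adj.
- by exists (g x); rewrite mem_gset g_adj neq.
- by exists (g y); rewrite mem_gset g_adj neq.
- have -> : [set x0 | [/\ x0 \in gset A, adj (g l) x0 & x0 != g l']]%classic =
    [set x0 | x0 \in gset A /\ (adj (g l) x0 && (x0 != g l'))]%classic.
    by apply/seteqP; split=> z /=; [case=> -> -> ->|case=> -> /andP[-> ->]].
  apply: (@connectedS_gset A (fun z => adj l z && (z != l'))) => [z|].
    by rewrite g_adj neq.
  have -> // : [set x0 | x0 \in A /\ (adj l x0 && (x0 != l'))]%classic =
    [set x0 | [/\ x0 \in A, adj l x0 & x0 != l']]%classic.
  by apply/seteqP; split=> z /=; [case=> -> /andP[-> ->]|case=> -> -> ->].
- have -> : [set x0 | [/\ x0 \in gset A, adj (g l') x0 & x0 != g l]]%classic =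
    [set x0 | x0 \in gset A /\ (adj (g l') x0 && (x0 != g l))]%classic.
    by apply/seteqP; split=> z /=; [case=> -> -> ->|case=> -> /andP[-> ->]].
  apply: (@connectedS_gset A (fun z => adj l' z && (z != l))) => [z|].
    by rewrite g_adj neq.
  have -> // : [set x0 | x0 \in A /\ (adj l' x0 && (x0 != l))]%classic =
    [set x0 | [/\ x0 \in A, adj l' x0 & x0 != l]]%classic.
  by apply/seteqP; split=> z /=; [case=> -> /andP[-> ->]|case=> -> -> ->].
Qed.

End Image.

Lemma fset_argmax (A : cfg) (p : pred point) (f : point -> int) x0 : x0 \in A -> p x0 ->
  exists P, [/\ P \in A, p P & forall x, x \in A -> p x -> f x <= f P].
Proof.
move=> x0A px0; pose i0 : A := [` x0A]%fset.
have [i pi mi] := @Order.TotalTheory.arg_maxP _ _ _ i0 (fun i : A => p (val i)) (fun i => f (val i)) px0.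
exists (val i); split=> //; first exact: valP.
by move=> x xA px; exact: (mi [` xA]%fset px).
Qed.

(** The reflection of the lattice that keeps every column and reverses it; it exchanges direction
    [i] with [5 - i], so the bottom of a column is treated as a top. *)
Definition flip (x : point) : point := (x.1, - x.1 - x.2).

Lemma flipK : involutive flip.
Proof. by case=> x y; rewrite /flip /=; congr pair; lia. Qed.

Lemma flip_adj a b : adj (flip a) (flip b) = adj a b.
Proof. by rewrite /adj /psub /dirs /flip !inE !xpair_eqE /=; lia. Qed.

Lemma lt_bound (h : nat) (p q : int) : q < p -> h%:Z - (p - q) < h.+1%:Z.
Proof. lia. Qed.

Lemma flip_bound (p q x y c : int) : q < p -> p <= - x - y -> x = c - 1 -> y <= - c - q.
Proof. lia. Qed.

Lemma int_squeeze (p q : int) : q < p -> p <= q + 1 -> q + 1 = p.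
Proof. lia. Qed.

(** * Sweeping the columns from left to right *)

Section Sweep.
Local Open Scope fset_scope.
Local Open Scope ring_scope.
Variables (n : nat) (U : cfg -> Prop).
Hypothesis n1 : (1 < n)%N.
Hypothesis Uconn : forall A, U A -> is_connected A.
Hypothesis Ucard : forall A, U A -> #|` A| = n.
Hypothesis Umove : forall A l i, U A -> l \in A -> move_allowed A l (nb l i) ->
  U (moved A l (nb l i)).

Let flip_inj : injective flip := can_inj flipK.

Lemma cfg_nb A a : U A -> a \in A -> exists2 j, (j < 6)%N & nb a j \in A.
Proof. by move=> UA; apply: connected_nb; [exact: Uconn|rewrite (Ucard UA)]. Qed.

Lemma cfg_height A x y : U A -> x \in A -> y \in A -> x.2 - y.2 <= (2 * (n - 1))%:Z.
Proof.
move=> UA xA yA; have [ds [sz _ vA]] := connected_visits (Uconn UA) yA.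
move: xA; rewrite vA => /visits_near[_]; rewrite sz (Ucard UA) => h.
exact: le_trans (ler_norm _) h.
Qed.

Lemma in_gset_flip A x : (x \in gset flip A) = (flip x \in A).
Proof. by rewrite -{1}[x]flipK mem_gset. Qed.

Lemma flip_nb x i : (i < 6)%N -> flip (nb x i) = nb (flip x) (5 - i).
Proof.
case: x => a b; rewrite /nb /padd /flip.
by case: i => [|[|[|[|[|[|//]]]]]] _ /=; congr pair; lia.
Qed.

(** The single particle of column [c - 1] can obstruct only one end of column [c]. If it spoils the
    top particle [P], it lies at least as high as [P], hence above the bottom particle [Q], and the
    reflected configuration satisfies the hypotheses of [top_reduce] at [Q]. *)
Lemma reduce_column A c : U A -> (forall x y, x \in A -> y \in A -> x.1 = c - 1 -> y.1 = c - 1 -> x = y) ->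
  (forall x, x \in A -> x.1 = c - 1 -> (nb x 0 \in A) || (nb x 5 \in A)) ->
  (exists x y, [/\ x \in A, y \in A, x.1 = c, y.1 = c & x <> y]) ->
  exists (A' : cfg) (P : point), [/\ U A', P \in A, P.1 = c, 
    forall x : point, x.1 < c -> (x \in A') = (x \in A) &
    forall x : point, x.1 = c -> (x \in A') = (x != P) && (x \in A)].
Proof.
move=> UA uniq1 att [x [y [xA yA xc yc xy]]].
have [P [PA /eqP Pc Ptop]] : exists P, [/\ P \in A, P.1 == c & forall x, x \in A -> x.1 == c -> x.2 <= P.2].
  by apply: (@fset_argmax A (fun x => x.1 == c) snd x xA); rewrite xc.
have [Q [QA /eqP Qc Qbot]] : exists Q, [/\ Q \in A, Q.1 == c & forall x, x \in A -> x.1 == c -> - x.2 <= - Q.2].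
  by apply: (@fset_argmax A (fun x => x.1 == c) (fun x => - x.2) x xA); rewrite xc.
have QP : Q.2 < P.2.
  have := Ptop x xA; have := Ptop y yA; have := Qbot x xA; have := Qbot y yA.
  rewrite xc yc eqxx => /(_ isT) h1 /(_ isT) h2 /(_ isT) h3 /(_ isT) h4.
  rewrite ltNge; apply/negP => h5; apply: xy; rewrite [x]surjective_pairing [y]surjective_pairing xc yc.
  congr pair; move: h1 h2 h3 h4 h5; clear; lia.
have PQ : P <> Q by move=> e; rewrite e ltxx in QP.
have Ptop' z : z \in A -> z.1 = c -> z.2 <= P.2 by move=> zA zc; apply: Ptop; rewrite // zc.
have Qbot' z : z \in A -> z.1 = c -> Q.2 <= z.2.
  by move=> zA zc; rewrite -lerN2; apply: Qbot; rewrite // zc.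
have attach z : z \in A -> z.1 = c - 1 -> [/\ z.2 <= P.2 + 1, Q.2 <= z.2 &
    (z = nb P 3 \/ z.2 <> P.2) /\ (z = nb Q 2 \/ z.2 <> Q.2 + 1)].
  move=> zA zc; split.
  - have /orP[h|h] := att z zA zc; have := Ptop' _ h; rewrite /nb /padd /= zc => /(_ (subrK _ _));
    clear; lia.
  - have /orP[h|h] := att z zA zc; have := Qbot' _ h; rewrite /nb /padd /= zc => /(_ (subrK _ _));
    clear; lia.
  - split.
      have [e|] := z.2 =P P.2; [left|by right].
      by rewrite [z]surjective_pairing zc e -Pc /nb /padd /= addr0.
    have [e|] := z.2 =P Q.2 + 1; [left|by right].
    by rewrite [z]surjective_pairing zc e -Qc /nb /padd /=.
have [/andP[g2 g3]|bad] := boolP [&& nb P 2 \notin A & (nb P 3 \in A) ==> (nb P 4 \in A)].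
  have [||||A' [UA' lA' cA']] := @top_reduce U Umove cfg_nb _ cfg_height (2 * (n - 1)).+1 c A P Q UA PA Pc Ptop' QA Qc.
  - by move=> e; apply: PQ.
  - exact: lt_bound.
  - move=> z zA zc; have [h1 _ _] := attach z zA zc.
    move: h1; rewrite le_eqVlt => /orP[/eqP e|]; last by rewrite ltzD1.
    suff ez : z = nb P 2 by rewrite -ez zA in g2.
    by rewrite [z]surjective_pairing zc e -Pc.
  - exact/implyP.
  by exists A', P.
pose U' A := U (gset flip A).
have U'move B l i : U' B -> l \in B -> move_allowed B l (nb l i) -> U' (moved B l (nb l i)).
  move=> UB lB /(gset_move flip_inj flip_adj) ok.
  rewrite /U' gset_moved //.
  have /adjP[j j6 e] : adj (flip l) (flip (nb l i)) by rewrite flip_adj adj_nb.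
  by rewrite e in ok *; apply: Umove; rewrite ?mem_gset.
have U'nb B a : U' B -> a \in B -> exists2 j, (j < 6)%N & nb a j \in B.
  move=> UB aB; have [|j j6 h] := @cfg_nb _ (flip a) UB; first by rewrite mem_gset.
  exists (5 - j)%N; first by rewrite ltnS leq_subr.
  by rewrite -[a]flipK -flip_nb // -in_gset_flip.
(* The reflected height mixes both coordinates, each of which varies by at most [2 * (n - 1)]. *)
have U'height B x' y' : U' B -> x' \in B -> y' \in B -> x'.2 - y'.2 <= (4 * (n - 1))%:Z.
  move=> UB xB yB.
  have xB' : flip x' \in gset flip B by rewrite mem_gset.
  have yB' : flip y' \in gset flip B by rewrite mem_gset.
  have [ds [sz _ vA]] := connected_visits (Uconn UB) yB'.
  move: xB'; rewrite vA => /visits_near[]; rewrite sz (Ucard UB) /=; clear; lia.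
have eA : gset flip (gset flip A) = A.
  by apply/fsetP => z; rewrite !in_gset_flip flipK.
have [t [tA tc tP]] : exists t, [/\ t \in A, t.1 = c - 1 & P.2 <= t.2].
  move: bad; rewrite negb_and negbK negb_imply => /orP[h|/andP[h _]].
    by exists (nb P 2); rewrite h /nb /padd /= Pc lerDl.
  by exists (nb P 3); rewrite h /nb /padd /= Pc addr0.
have [||||||||||A' [UA' lA' cA']] := @top_reduce U' U'move U'nb _ U'height (4 * (n - 1)).+1 c
    (gset flip A) (flip Q) (flip P).
- by rewrite /U' eA.
- by rewrite mem_gset.
- by [].
- move=> z; rewrite in_gset_flip => zA zc; have := Qbot' _ zA zc.
  by rewrite /= zc Qc; clear; lia.
- by rewrite mem_gset.
- by [].
- by move=> /flip_inj e; apply: PQ.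
- by apply: lt_bound; rewrite /= Pc Qc ltrD2l ltrN2.
- move=> z; rewrite in_gset_flip => zA zc.
  have e := uniq1 _ _ zA tA zc tc.
  by move: tP zc; rewrite -e /= Qc => h1 h2; exact: flip_bound QP h1 h2.
(* If [nb Q 2] is occupied it is [t], which is at height at least [P.2]; so [P] sits immediately
   above [Q] and is the required link [nb Q 1]. *)
- rewrite -[3%N]/(5 - 2)%N -[4%N]/(5 - 1)%N -!flip_nb // !mem_gset // => Q2.
  have e : nb Q 2 = t by apply: uniq1; rewrite // /nb /padd /= Qc.
  suff -> : nb Q 1 = P by [].
  rewrite [P]surjective_pairing Pc -Qc /nb /padd /= addr0; congr pair.
  by move: tP; rewrite -e /= => tP; exact: int_squeeze QP tP.
exists (gset flip A'), Q; split=> //.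
- by move=> z zc; rewrite in_gset_flip lA' // in_gset_flip flipK.
- by move=> z zc; rewrite in_gset_flip cA' // in_gset_flip flipK (inj_eq flip_inj).
Qed.

Lemma right_nb (x y : point) : adj x y -> y.1 = x.1 + 1 -> y = nb x 0 \/ y = nb x 5.
Proof.
move=> /adjP[[|[|[|[|[|[|//]]]]]] _ ->]; rewrite /nb /padd /=; try by clear; lia.
- by left.
- by right.
Qed.

Lemma adj_col (x y : point) : adj x y -> y.1 <= x.1 + 1.
Proof. by move=> /adjP[[|[|[|[|[|[|//]]]]]] _ ->]; rewrite /nb /padd /=; clear; lia. Qed.

(** The measure is lexicographic: particles not yet to the left of column [c], then particles in
    column [c]. The factor [n.+1] exceeds the size of any column, so advancing pays for whatever the
    next column contains. One particle always stays behind in column [c], which keeps the left part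
    attached. *)
Lemma sweep m (A : cfg) (c : int) : U A ->
  ((n - #|` [fset x in A | (x.1 < c)%R]|) * n.+1 + #|` [fset x in A | x.1 == c]| < m)%N ->
  (forall x y, x \in A -> y \in A -> x.1 = y.1 -> x.1 < c -> x = y) ->
  (exists2 x, x \in A & x.1 = c) ->
  exists2 L : cfg, U L & forall x y, x \in L -> y \in L -> x.1 = y.1 -> x = y.
Proof.
elim: m A c => [//|m IH] A c UA hm thin [x0 x0A x0c].
have [[x [xA xc xx0]]|single] := pselect (exists x, [/\ x \in A, x.1 = c & x <> x0]).
  have cc1 : c - 1 < c by clear; lia.
  have [|||A' [P [UA' PA Pc lA' cA']]] := @reduce_column A c UA.
  - by move=> y z yA zA yc zc; apply: thin; rewrite ?yc ?zc.
  (* Otherwise a path from [z] to [x0] could never leave the columns up to [c - 1], since [z] is the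
     only particle of column [c - 1]. *)
  - move=> z zA zc; apply: contrapT => /negP; rewrite negb_or => /andP[z0 z5].
    have : [set y : point | y \in A /\ y.1 <= c - 1]%classic x0.
      apply: (@lpath_inv (occ A) _ z); last exact: (Uconn UA); last by rewrite /= zc.
      move=> u v /= [uA uc] vA uv; split=> //.
      have [vc|] := v.1 =P c; last by move: (adj_col uv) uc; clear; lia.
      have uc' : u.1 = c - 1 by move: (adj_col uv) uc; rewrite vc; clear; lia.
      have uz : u = z by apply: thin; rewrite // ?uc' ?zc.
      have [e|e] : v = nb u 0 \/ v = nb u 5 by apply: right_nb; rewrite // vc uc' subrK.
        by rewrite -uz -e vA in z0.
      by rewrite -uz -e vA in z5.
    by rewrite /= x0c => -[_]; clear; lia.
  - by exists x, x0.
  apply: (IH A' c) => //.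
  - rewrite ltnS in hm; apply: leq_trans hm.
    have -> : [fset x in A' | (x.1 < c)%R] = [fset x in A | (x.1 < c)%R].
      apply/fsetP => z; rewrite !inE /=.
      by case: (boolP (z.1 < c)) => zc; rewrite ?andbF // lA'.
    rewrite -addnS leq_add2l.
    have -> : [fset x in A | x.1 == c] = P |` [fset x in A' | x.1 == c].
      apply/fsetP => z; rewrite !inE /=.
      have [zc|nzc] := z.1 =P c; last first.
        by rewrite !andbF orbF; apply/esym/eqP => e; apply: nzc; rewrite e.
      by rewrite !andbT cA' //; case: (z =P P) => [->|].
    by rewrite cardfsU1 !inE cA' // eqxx.
  - move=> y z yA zA yz yc; apply: thin => //; first by rewrite -lA'.
    by rewrite -lA' // -yz.
  - have [e|e] := x =P P; [exists x0 | exists x] => //; rewrite cA' //.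
      by rewrite x0A andbT; apply/eqP => e0; apply: xx0; rewrite e e0.
    by rewrite xA andbT; apply/eqP.
have thin1 x y : x \in A -> y \in A -> x.1 = y.1 -> x.1 < c + 1 -> x = y.
  move=> xA yA xy xc; have [xc'|xc'] : x.1 < c \/ x.1 = c by move: xc; clear; lia.
    exact: thin.
  have e z : z \in A -> z.1 = c -> z = x0.
    by move=> zA zc; apply: contrapT => nz; apply: single; exists z.
  by rewrite (e x) // (e y) // -xy.
have [[y yA yc]|none] := pselect (exists2 y, y \in A & y.1 = c + 1).
  apply: (IH A (c + 1)) => //; last by exists y.
  rewrite ltnS in hm; apply: leq_trans hm.
  set a := #|` [fset x in A | (x.1 < c)%R]|; set b := #|` _|; set d := #|` _|.
  have cn : (d <= n)%N.
    by rewrite -(Ucard UA); apply: fsubset_leq_card; apply/fsubsetP => z; rewrite !inE => /andP[].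
  have bn : (b <= n)%N.
    by rewrite -(Ucard UA); apply: fsubset_leq_card; apply/fsubsetP => z; rewrite !inE => /andP[].
  have ab : (a < b)%N.
    apply: fproper_ltn_card; rewrite fproperE; apply/andP; split.
      apply/fsubsetP => z; rewrite !inE /= => /andP[-> /=]; clear; lia.
    by apply/fsubsetPn; exists x0; rewrite !inE /= x0A x0c /= ?ltxx // ltzD1.
  have : (0 < #|` [fset x in A | x.1 == c]|)%N.
    by rewrite cardfs_gt0; apply/fset0Pn; exists x0; rewrite !inE /= x0A x0c eqxx.
  by move: cn bn ab; clear; nia.
exists A => // x y xA yA xy; apply: thin1 => //.
have [_] : [set y : point | y \in A /\ y.1 <= c]%classic x.
  apply: (@lpath_inv (occ A) _ x0); last exact: (Uconn UA); last by rewrite /= x0c.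
  move=> u v /= [uA uc] vA uv; split=> //.
  have vc : v.1 <> c + 1 by move=> e; apply: none; exists v.
  by move: (adj_col uv) uc vc; clear; lia.
by rewrite /= ltzD1.
Qed.

(* Such an L contains no triangular face. *)
Lemma reach_thin A0 : U A0 ->
  exists2 L : cfg, U L & forall x y, x \in L -> y \in L -> x.1 = y.1 -> x = y.
Proof.
move=> UA0; have /fset0Pn[a aA] : A0 != fset0.
  by rewrite -cardfs_gt0 (Ucard UA0) ltnW.
have [P [PA _ Pmin]] := @fset_argmax A0 predT (fun x => - x.1) a aA isT.
apply: (@sweep _ A0 P.1 UA0 (ltnSn _)); last by exists P.
by move=> x y xA _ _; have := Pmin x xA isT; rewrite lerN2 leNgt => /negbTE ->.
Qed.
End Sweep.

(** * Planar topology *)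

Lemma row_path (S : set point) (x x' y : int) : (forall z, S (z, y)) -> lpath S (x, y) (x', y).
Proof.
move=> Sy; have H k (z : int) : lpath S (z, y) (z + k%:Z, y).
  elim: k => [|k IH]; first by rewrite addr0; apply: lpath_refl.
  apply: (lpath_trans IH); apply: lpath1; last exact: Sy.
  have -> : (z + k.+1%:Z, y) = nb (z + k%:Z, y) 0 by rewrite /nb /padd /= addr0; congr pair; clear; lia.
  exact: adj_nb.
have [h|h] := leP x x'.
  by have := H `|x' - x|%N x; have -> : x + `|x' - x|%N%:Z = x' by move: h; clear; lia.
apply: lpath_sym; first exact: Sy.
by have := H `|x - x'|%N x'; have -> : x' + `|x - x'|%N%:Z = x by move: h; clear; lia.
Qed.

Lemma column_path (S : set point) (x y y' : int) : (forall z, S (x, z)) -> lpath S (x, y) (x, y').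
Proof.
move=> Sy; have H k (z : int) : lpath S (x, z) (x, z + k%:Z).
  elim: k => [|k IH]; first by rewrite addr0; apply: lpath_refl.
  apply: (lpath_trans IH); apply: lpath1; last exact: Sy.
  have -> : (x, z + k.+1%:Z) = nb (x, z + k%:Z) 1 by rewrite /nb /padd /= addr0; congr pair; clear; lia.
  exact: adj_nb.
have [h|h] := leP y y'.
  by have := H `|y' - y|%N y; have -> : y + `|y' - y|%N%:Z = y' by move: h; clear; lia.
apply: lpath_sym; first exact: Sy.
by have := H `|y - y'|%N y'; have -> : y' + `|y - y'|%N%:Z = y by move: h; clear; lia.
Qed.

Lemma box_finite (M : nat) : finite_set [set x : point | `|x.1| <= M%:Z /\ `|x.2| <= M%:Z].
Proof.
pose f (p : nat * nat) : point := (p.1%:Z - M%:Z, p.2%:Z - M%:Z).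
pose s := [seq f p | p <- [seq (i, j) | i <- iota 0 (2 * M).+1, j <- iota 0 (2 * M).+1]].
apply: (@sub_finite_set _ _ [set` s]); last exact: finite_seq.
move=> [x y] /= [hx hy]; apply/mapP; exists (absz (x + M%:Z), absz (y + M%:Z)).
  apply/allpairsP; exists (absz (x + M%:Z), absz (y + M%:Z)); rewrite !mem_iota /=.
  by split=> //; move: hx hy; clear; lia.
by rewrite /f /=; congr pair; move: hx hy; clear; lia.
Qed.

Lemma box_bound (A : cfg) : exists M : nat, forall x, x \in A -> `|x.1| <= M%:Z /\ `|x.2| <= M%:Z.
Proof.
exists (\sum_(x <- A) (`|x.1| + `|x.2|))%N => x xA.
by rewrite (big_rem x) //=; clear; set s := (\sum_(_ <- _) _)%N; lia.
Qed.

(** If the component of an empty site were finite, it would be a hole; so it leaves the bounding box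
    of [A]. Outside the box every site is joined to one fixed [corner] by a row and a column that
    avoid [A]. *)
Lemma compl_connected (A : cfg) : no_holes A -> connectedS (~` occ A)%classic.
Proof.
move=> nh; have [M bM] := box_bound A.
have free (x : point) : M%:Z < `|x.1| \/ M%:Z < `|x.2| -> (~` occ A)%classic x.
  by case=> [h /bM[+ _]|h /bM[_ +]]; rewrite leNgt h.
pose corner : point := (M%:Z + 1, M%:Z + 1).
have far (x : point) : M%:Z < `|x.1| \/ M%:Z < `|x.2| -> lpath (~` occ A)%classic x corner.
  case: x => x y [h|h].
    apply: (lpath_trans (b := (x, M%:Z + 1))).
      by apply: column_path => z; apply: free; left.
    by apply: row_path => z; apply: free; right; rewrite /=; clear; lia.
  apply: (lpath_trans (b := (M%:Z + 1, y))).
    by apply: row_path => z; apply: free; right.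
  by apply: column_path => z; apply: free; left; rewrite /=; clear; lia.
have to_corner (a : point) : (~` occ A)%classic a -> lpath (~` occ A)%classic a corner.
  move=> aA; pose H : set point := [set x | (~` occ A)%classic x /\ lpath (~` occ A)%classic a x]%classic.
  have Ha : H a by split=> //; exact: lpath_refl.
  have HH x y : H x -> (~` occ A)%classic y -> adj x y -> H y.
    by move=> [xA ax] yA xy; split=> //; exact: lpath_trans ax (lpath1 xy yA).
  have inH b : H b -> lpath H a b.
    move=> [bA [s [ps ls Ss]]]; exists s; split=> // x xs.
    have [s1 [s2 es]] : exists s1 s2, s = rcons s1 x ++ s2 by case/splitPr: xs => s1 s2; exists s1, s2; rewrite cat_rcons.
    split; first exact: Ss.
    exists (rcons s1 x); split; rewrite ?last_rcons //.
      by move: ps; rewrite es cat_path => /andP[].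
    by move=> z zs; apply: Ss; rewrite es mem_cat zs.
  have infH : ~ finite_set H.
    move=> finH; apply: (nh H); split=> //.
    - by move=> x [].
    - by move=> x y Hx Hy; apply: (lpath_trans (b := a)); [apply: lpath_sym (inH _ Hx)|exact: inH].
    - move=> K finK cK KA HK; apply/seteqP; split=> // x Kx; split; first exact: KA.
      by apply: lpath_sub (cK a x (HK _ Ha) Kx) => y /KA.
  have [x [Hx xM]] : exists x, H x /\ (M%:Z < `|x.1| \/ M%:Z < `|x.2|).
    apply: contrapT => no; apply: infH; apply: (@sub_finite_set _ _ _ _ (box_finite M)).
    move=> x Hx /=; split; rewrite leNgt; apply/negP => h; apply: no; exists x; split=> //; by [left|right].
  by apply: lpath_trans (far x xM); case: Hx.
move=> a b aA bA; apply: lpath_trans (to_corner a aA) _.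
exact: lpath_sym (to_corner b bA).
Qed.

(** The discrete antiderivative of [g] modulo 2 that vanishes at 0; on the negative side the terms
    run over -1, -2, and so on, as [Negz i] is -(i + 1). *)
Definition primitive (g : int -> bool) (x : int) : bool :=
  match x with
  | Posz n => \big[addb/false]_(i < n) g i%:Z
  | Negz n => \big[addb/false]_(i < n.+1) g (Negz i)
  end.

Lemma primitiveS g x : primitive g (x + 1) = primitive g x (+) g x.
Proof.
case: x => [n|[|n]].
- have -> : Posz n + 1 = Posz n.+1 by clear; lia.
  by rewrite /= big_ord_recr.
- by rewrite /= big_ord_recl !big_ord0 addbF addbb.
- have -> : Negz n.+1 + 1 = Negz n by clear; lia.
  by rewrite /= [in RHS]big_ord_recr /= -addbA addbb addbF.
Qed.

Lemma int_invariant (D : int -> bool) x y : (forall z, D (z + 1) = D z) -> D x = D y.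
Proof.
move=> inv; suff H z : D z = D 0 by rewrite !H.
elim/int_ind: z => [//|n <-|n <-]; first by rewrite -[RHS]inv; congr D; clear; lia.
by rewrite -[LHS]inv; congr D; clear; lia.
Qed.

(* A Z/2-valued 1-cochain on the triangular lattice whose sum over each face
   vanishes is the coboundary of some f: the lattice is simply connected. *)
Lemma coboundary (E : point -> nat -> bool) :
  (forall a i, E (nb a i) (i + 3)%N = E a i) ->
  (forall a i, E a i (+) E (nb a i) (i + 2)%N = E a i.+1) ->
  exists f : point -> bool, forall a i, (i < 6)%N -> f a (+) f (nb a i) = E a i.
Proof.
move=> Erev Eface.
(* [E] is integrated from the origin along the column x = 0 and then along a row; the vanishing of
   [E] on faces makes the result correct in the other directions too. *)
pose f (a : point) := primitive (fun y => E (0, y) 1%N) a.2 (+) primitive (fun x => E (x, a.2) 0%N) a.1.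
have f0 a : f a (+) f (nb a 0) = E a 0%N.
  case: a => x y; rewrite /f /nb /padd /= addr0 primitiveS.
  by case: (primitive _ y); case: (primitive _ x); case: (E _ _).
have square (x y : int) : E (x, y) 0%N (+) E (x, y + 1) 0%N = E (x, y) 1%N (+) E (x + 1, y) 1%N.
  have := Eface (x, y) 0%N; have := Eface (x + 1, y) 1%N.
  have -> : nb (x, y) 0 = (x + 1, y) by rewrite /nb /padd /= addr0.
  have -> : nb (x + 1, y) 1 = (x + 1, y + 1) by rewrite /nb /padd /= addr0.
  have := Erev (x, y + 1) 0%N.
  have -> : nb (x, y + 1) 0 = (x + 1, y + 1) by rewrite /nb /padd /= addr0.
  by move=> /= -> <- <-; case: (E (x, y) 0%N); case: (E (x + 1, y) 1%N); case: (E (x, y + 1) 0%N).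
have f1 a : f a (+) f (nb a 1) = E a 1%N.
  case: a => x y; rewrite /f /nb /padd /= addr0 primitiveS.
  pose D z := primitive (fun x => E (x, y) 0%N) z (+) primitive (fun x => E (x, y + 1) 0%N) z (+) E (z, y) 1%N.
  have : D x = D 0.
    apply: int_invariant => z; rewrite /D !primitiveS; have := square z y.
    case: (E (z, y) 1%N); case: (E (z + 1, y) 1%N); case: (E (z, y) 0%N); case: (E (z, y + 1) 0%N) => //= _;
    by case: (primitive _ _); case: (primitive _ _).
  rewrite /D /= !big_ord0 /=.
  case: (E (0, y) 1%N); case: (E (x, y) 1%N); case: (primitive _ y);
    by case: (primitive _ x); case: (primitive _ x).
have f2 a : f a (+) f (nb a 2) = E a 2%N.
  have := Eface a 1%N; have := Erev (nb a 2) 0%N; have := f1 a; have := f0 (nb a 2).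
  have -> : nb (nb a 2) 0 = nb a 1 by offsets.
  by move=> <- <- /= -> <-; case: (f a); case: (f _); case: (f _).
have rev a i : f a (+) f (nb a i) = E a i -> f (nb a i) (+) f (nb (nb a i) (i + 3)) = E (nb a i) (i + 3)%N.
  by rewrite Erev nbK addbC.
exists f => a [|[|[|[|[|[|//]]]]]] _ //.
- have e : nb (nb a 3) 0 = a by exact: (nbK a 3).
  by have := rev _ _ (f0 (nb a 3)); rewrite e.
- have e : nb (nb a 4) 1 = a by exact: (nbK a 4).
  by have := rev _ _ (f1 (nb a 4)); rewrite e.
- have e : nb (nb a 5) 2 = a by exact: (nbK a 5).
  by have := rev _ _ (f2 (nb a 5)); rewrite e.
Qed.

(** * The boundary walk *)

Lemma nb_modD v i k : nb v (i %% 6 + k) = nb v (i + k).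
Proof. by rewrite -nb_mod modnDml nb_mod. Qed.

(* The states of the boundary walk: a particle v together with the first
   unoccupied direction s after an occupied one, i.e. the start of a sector of
   unoccupied neighbours. *)
Definition corner (A : cfg) (st : point * nat) : bool :=
  [&& st.1 \in A, (st.2 < 6)%N, nb st.1 st.2 \notin A & nb st.1 (st.2 + 5) \in A].

(** On arrival at the new particle, direction [s + k + 4] points to the last empty site swept and
    the direction just before it points back to [v]. This is why the walk goes from corner to
    corner. *)
Lemma wstepP (A : cfg) v s : v \in A -> nb v s \notin A ->
  (exists2 i, (i < 6)%N & nb v i \in A) ->
  exists k, [/\ (0 < k < 6)%N, forall k', (k' < k)%N -> nb v (s + k') \notin A,
    wstep A (v, s) = (nb v (s + k), (s + k + 4) %% 6)%N & corner A (wstep A (v, s))].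
Proof.
move=> vA sA [i i6 iA].
set p := fun k => padd v (dir (s + k)) \in A; pose k := find p (iota 0 6).
have hp : has p (iota 0 6).
  have [j j6 ej] := adjP_from s (adj_nb v i).
  by apply/hasP; exists j; rewrite ?mem_iota // /p -/(nb v (s + j)) -ej.
have k6 : (k < 6)%N by rewrite -[6%N](size_iota 0) -has_find.
have kp : nb v (s + k) \in A by have := nth_find 0%N hp; rewrite nth_iota.
have before k' : (k' < k)%N -> nb v (s + k') \notin A.
  by move=> k'k; have := before_find 0%N k'k; rewrite nth_iota ?(ltn_trans k'k) // /p => /negbT.
have k0 : (0 < k)%N by case: (k) kp => [|//]; rewrite addn0 (negbTE sA).
have e : wstep A (v, s) = (nb v (s + k), (s + k + 4) %% 6)%N.
  by rewrite /wstep -/p -/k dir_mod modnDml.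
exists k; split=> //; first by rewrite k0.
rewrite e /corner /= kp ltn_mod nb_mod nb_turn4 nb_modD -!addnA /=; apply/andP; split=> //.
  have -> : (k + 5 = 6 + k.-1)%N by rewrite -{1}(prednK k0) addSn addnC.
  by rewrite nb6; apply: before; rewrite prednK.
by rewrite addnA -[(4 + 5)%N]/(6 + 3)%N nb6 nbK.
Qed.

Lemma nb_eqmod v i j : (i = j %[mod 6])%N -> nb v i = nb v j.
Proof. by move=> e; rewrite -nb_mod e nb_mod. Qed.

Section Perimeter.
Variables (A : cfg) (s1 : point * nat) (k : nat).
Hypotheses (cA : is_connected A) (nh : no_holes A).
Hypotheses (c1 : corner A s1) (ret : iter k.+1 (wstep A) s1 = s1).

Let orbit st := exists i, st = iter i (wstep A) s1.

Lemma corner_step st : corner A st -> corner A (wstep A st).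
Proof.
case: st => v s /and4P[/= vA s6 sA s5].
have [|j [_ _ _ //]] := wstepP vA sA.
by have [j j6 e] := adjP _ _ (adj_nb v (s + 5)); exists j; rewrite // -e.
Qed.

Lemma orbit_corner st : orbit st -> corner A st.
Proof. by case=> i ->; elim: i => //= i; apply: corner_step. Qed.

Lemma orbit_pred st : orbit st -> exists2 st', orbit st' & st = wstep A st'.
Proof.
case=> [[|i] ->]; last by exists (iter i (wstep A) s1) => //; exists i.
by exists (iter k (wstep A) s1); [exists k|rewrite /= -iterS ret].
Qed.

(* The boundary edge from v in direction s belongs to a sector on the walk. *)
Let Z v s := exists s' j, [/\ orbit (v, s'), (j < 6)%N, (s' + j = s %[mod 6])%N &
  forall j', (j' <= j)%N -> nb v (s' + j') \notin A].

Let Zmod v s t : (s = t %[mod 6])%N -> Z v s -> Z v t.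
Proof. by move=> e [s' [j [? ? es ?]]]; exists s', j; split=> //; rewrite es. Qed.

Let sector v s' j : orbit (v, s') -> (forall j', (j' <= j)%N -> nb v (s' + j') \notin A) -> (j < 5)%N.
Proof.
move=> /orbit_corner/and4P[_ _ _ s5] H; rewrite /= in s5; rewrite ltnNge; apply/negP => j5.
by have := H _ j5; rewrite s5.
Qed.

Let Z_turn v s : nb v s.+1 \notin A -> Z v s -> Z v s.+1.
Proof.
move=> sA [s' [j [ho j6 es H]]]; have j5 := sector ho H.
exists s', j.+1; split=> //.
  by rewrite addnS -addn1 -modnDml es modnDml addn1.
move=> j'; rewrite leq_eqVlt => /orP[/eqP ->|]; last exact: H.
rewrite (@nb_eqmod _ _ s.+1) // addnS -addn1 -modnDml es modnDml addn1 //.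
Qed.

Let Z_unturn v s : nb v s \notin A -> Z v s.+1 -> Z v s.
Proof.
move=> sA [s' [[|j] [ho j6 es H]]].
  have /and4P[_ _ _ /= s5] := orbit_corner ho.
  suff e : nb v (s' + 5) = nb v s by rewrite e (negbTE sA) in s5.
  apply: nb_eqmod; rewrite -modnDml -[s' in LHS]addn0 es modnDml addSn -addnS.
  by rewrite modnDr.
exists s', j; split=> //; first exact: ltnW.
  by apply/eqP; rewrite -(eqn_modDr 1) !addn1 -addnS es.
by move=> j' j'j; apply: H; apply: leqW.
Qed.

Let Z_step v s : nb v s.+1 \in A -> Z v s -> Z (nb v s.+1) (s + 5).
Proof.
move=> sA [s' [j [ho j6 es H]]]; have j5 := sector ho H.
have es1 : (s' + j.+1 = s.+1 %[mod 6])%N.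
  by rewrite addnS -addn1 -modnDml es modnDml addn1.
have /and4P[/= vA s'6 s'A s'5] := orbit_corner ho.
have [|k' [/andP[k'0 k'6] H' e /andP[wA _]]] := wstepP vA s'A.
  by have [i i6 ei] := adjP _ _ (adj_nb v (s' + 5)); exists i; rewrite // -ei.
have ek : k' = j.+1.
  apply/eqP; rewrite eqn_leq; apply/andP; split.
    by rewrite leqNgt; apply/negP => /H'; rewrite (nb_eqmod _ es1) sA.
  by rewrite ltnNge; apply/negP => /H; rewrite e /= in wA; rewrite wA.
exists ((s' + j.+1 + 4) %% 6)%N, 0%N; split=> //.
- case: ho => i ei; exists i.+1; rewrite /= -ei e ek.
  by rewrite (nb_eqmod _ es1).
- by rewrite addn0 modn_mod -modnDml es1 modnDml addSn -addnS.
- move=> j'; rewrite leqn0 => /eqP ->; rewrite addn0 nb_mod.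
  have -> : nb (nb v s.+1) (s' + j.+1 + 4) = nb (nb v s.+1) (s + 5).
    by apply: nb_eqmod; rewrite -modnDml es1 modnDml addSn -addnS.
  by rewrite nb_turnr -(nb_eqmod _ es) H.
Qed.

Let Z_unstep v s : v \in A -> nb v s.+1 \in A -> Z (nb v s.+1) (s + 5) -> Z v s.
Proof.
move=> vA uA [s' [j [ho j6 es H]]].
have j0 : j = 0%N.
  case: j es H {j6} => // j es H; have := H j (leqnSn j).
  have -> : nb (nb v s.+1) (s' + j) = nb (nb v s.+1) (s.+1 + 3).
    apply: nb_eqmod; apply/eqP; rewrite -(eqn_modDr 1) !addn1 -addnS es; apply/eqP; congr (_ %% 6)%N.
    by rewrite addSn -!addnS.
  by rewrite nbK vA.
rewrite j0 addn0 in es.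
have [[w t] ow ew] := orbit_pred ho.
have /and4P[/= wA t6 tA t5] := orbit_corner ow.
have [|k' [/andP[k'0 k'6] H' e _]] := wstepP wA tA.
  by have [i i6 ei] := adjP _ _ (adj_nb w (t + 5)); exists i; rewrite // -ei.
rewrite e in ew; have eu := congr1 fst ew; have es' := congr1 snd ew; rewrite /= in eu es'.
have et : (t + k' = s.+1 %[mod 6])%N.
  apply/eqP; rewrite -(eqn_modDr 4); apply/eqP.
  by rewrite -(modn_mod (t + k' + 4)) -es' es addSn -addnS.
have ewv : w = v.
  have : nb (nb w (t + k')) (t + k' + 3) = nb (nb v s.+1) (s.+1 + 3).
    by rewrite -eu; apply: nb_eqmod; rewrite -modnDml et modnDml.
  by rewrite !nbK.
subst w; exists t, k'.-1; split=> //.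
- exact: leq_ltn_trans (leq_pred _) k'6.
- by apply/eqP; rewrite -(eqn_modDr 1) !addn1 -addnS prednK // et.
- by move=> j' j'k; apply: H'; rewrite -(prednK k'0) ltnS.
Qed.

Let Zb v s : bool := `[< Z v s >].

Let ZbS v s : nb v s \notin A -> nb v s.+1 \notin A -> Zb v s.+1 = Zb v s.
Proof. by move=> h h'; apply/asboolP/asboolP; [exact: Z_unturn|exact: Z_turn]. Qed.

Let Zb_step v s : v \in A -> nb v s.+1 \in A -> Zb (nb v s.+1) (s + 5) = Zb v s.
Proof. by move=> h h'; apply/asboolP/asboolP; [exact: Z_unstep|exact: Z_step]. Qed.

Let Zb_mod v s t : (s = t %[mod 6])%N -> Zb v s = Zb v t.
Proof. by move=> e; apply/asboolP/asboolP; apply: Zmod. Qed.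

(** The indicator of the edges that join a particle to an empty site and are swept by the walk,
    written symmetrically in the two ends. *)
Let E a i : bool :=
  if a \in A then (nb a i \notin A) && Zb a i else (nb a i \in A) && Zb (nb a i) (i + 3).

Let Erev a i : E (nb a i) (i + 3) = E a i.
Proof.
rewrite /E nbK; case: (a \in A); case: (nb a i \in A) => //=.
by apply: Zb_mod; rewrite -addnA modnDr.
Qed.

(** A face with vertices of both kinds has exactly two edges crossing the boundary. If these share
    their particle, they lie in one sector ([ZbS]); if they share the empty site, the walk steps
    from one particle to the other ([Zb_step]). So the walk sweeps both or neither. *)
Let Eface a i : E a i (+) E (nb a i) (i + 2) = E a i.+1.
Proof.
have e2 := nb_turn a i; rewrite /E e2.
have e3 : nb (nb a i) (i + 2).+1 = a by rewrite -addnS nbK.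
have e4 : nb (nb a i.+1) (i + 4) = a by rewrite addnS -addSn nbK.
have e5 : nb (nb a i.+1) (i + 4).+1 = nb a i by rewrite -addnS nb_turnr.
have m9 : (i + 4 + 5 = i + 3 %[mod 6])%N by rewrite -addnA -[(4 + 5)%N]/(3 + 6)%N addnA modnDr.
have m7 : (i + 2 + 5 = i.+1 %[mod 6])%N.
  by rewrite -addnA -[(2 + 5)%N]/(1 + 6)%N addnA modnDr addn1.
have -> : (i + 2 + 3 = i + 5)%N by rewrite -addnA.
have -> : (i.+1 + 3 = i + 4)%N by rewrite addSn -addnS.
have [aA|aA] := boolP (a \in A); have [bA|bA] := boolP (nb a i \in A);
  have [cA'|cA'] := boolP (nb a i.+1 \in A) => //=.
- by rewrite -(Zb_mod _ m7) -(@Zb_step (nb a i) (i + 2)) ?e3.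
- by rewrite Zb_step // addbb.
- by rewrite addbF ZbS.
- by rewrite addbF -(Zb_mod _ m9) -(@Zb_step (nb a i.+1) (i + 4)) ?e5.
- by rewrite (addnS i 2) ZbS ?e2 ?e3 // addbb.
- by rewrite [(i + 5)%N](addnS i 4) ZbS ?e4 ?e5.
Qed.

(** By [coboundary], [E] is the coboundary of some [f]. No edge inside [A] or inside its complement
    crosses the boundary, so [f] is constant on each of these connected sets. Hence [E] takes one
    value on all crossing edges, and this value is true at the start of the walk. *)
Lemma orbit_all st : corner A st -> orbit st.
Proof.
case: st => v s cst; have /and4P[/= vA s6 sA s5] := cst.
have [f fE] := coboundary Erev Eface.
have [[v1' t1'] es1] : {p | s1 = p} by exists s1.
have := c1; rewrite es1 => /and4P[/= v1A t16 t1A t15].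
have Z1 : Zb v1' t1'.
  apply/asboolP; exists t1', 0%N; split=> //; [by exists 0%N; rewrite -es1|by rewrite addn0|].
  by move=> j'; rewrite leqn0 => /eqP ->; rewrite addn0.
have fA x y : x \in A -> y \in A -> f x = f y.
  move=> xA yA; have [_ ->] // : [set z | z \in A /\ f x = f z]%classic y.
  apply: (lpath_inv (S := occ A) (a := x)) => //; last exact: cA.
  move=> z t /= [zA ->] tA /adjP[i i6 et]; split=> //.
  have : f z (+) f (nb z i) = false by rewrite fE // /E zA -et tA.
  by rewrite -et; case: (f z); case: (f t).
have fC x y : x \notin A -> y \notin A -> f x = f y.
  move=> xA yA; have [_ ->] // : [set z | z \notin A /\ f x = f z]%classic y.
  apply: (lpath_inv (S := (~` occ A)%classic) (a := x)) => //; last first.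
    by apply: (compl_connected nh); rewrite /= /occ /=; apply/negP.
  move=> z t /= [zA ->] /negP tA /adjP[i i6 et]; split=> //.
  have : f z (+) f (nb z i) = false by rewrite fE // /E (negbTE zA) -et (negbTE tA).
  by rewrite -et; case: (f z); case: (f t).
have : E v s.
  rewrite -fE // (fA v v1') // (fC (nb v s) (nb v1' t1')) // fE //.
  by rewrite /E v1A t1A Z1.
rewrite /E vA sA /= => /asboolP[s' [j [ho j6 es H]]].
have /and4P[_ s'6 _ _] := orbit_corner ho; rewrite /= in s'6.
have j0 : j = 0%N.
  case: j es H {j6} => // j es H; have := H j (leqnSn j).
  have -> : nb v (s' + j) = nb v (s + 5); last by rewrite s5.
  apply: nb_eqmod; apply/eqP; rewrite -(eqn_modDr 1) !addn1 -addnS es -addnS.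
  by rewrite modnDr.
by rewrite j0 addn0 !modn_small // in es; rewrite -es.
Qed.
End Perimeter.

(** * The anchor particle and the lower bound on the perimeter *)

Lemma pbetter_total (a b : point) : [\/ a = b, pbetter a b | pbetter b a].
Proof.
case: a b => [x y] [x' y']; rewrite /pbetter /=.
have [h|h|h] := ltgtP (2 * x' + y') (2 * x + y).
- by constructor 2.
- by constructor 3.
- rewrite /=; have [h'|h'|h'] := ltgtP y y'; [by constructor 3|by constructor 2|constructor 1].
  by rewrite h'; congr pair; move: h; rewrite h'; clear; lia.
Qed.

Lemma pbetter_trans (a b c : point) : pbetter a b -> pbetter b c -> pbetter a c.
Proof. by case: a b c => [x y] [x' y'] [x'' y'']; rewrite /pbetter /=; clear; lia. Qed.

Lemma pbetter_irr (a : point) : pbetter a a = false.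
Proof. by rewrite /pbetter !ltxx andbF. Qed.

Lemma pbetter_padd (p a b : point) : pbetter (padd p a) (padd p b) = pbetter a b.
Proof. by case: p a b => [x y] [x' y'] [x'' y'']; rewrite /pbetter /padd /=; clear; lia. Qed.

Lemma anchorP (A : cfg) : A != fset0 ->
  anchor A \in A /\ forall b, b \in A -> b = anchor A \/ pbetter (anchor A) b.
Proof.
move=> /fset0Pn[a0 a0A].
have H (s : seq point) z : let r := foldr (fun a b => if pbetter a b then a else b) z s in
    r \in z :: s /\ forall b, b \in z :: s -> b = r \/ pbetter r b.
  elim: s => [|a s [IH1 IH2]] /=.
    by rewrite inE eqxx; split=> // b; rewrite inE => /eqP ->; left.
  set r := foldr _ _ _ in IH1 IH2 *.
  have [ar|ar] := boolP (pbetter a r).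
    split; first by rewrite !inE eqxx orbT.
    move=> b; rewrite !inE orbCA => /orP[/eqP ->|bs]; first by left.
    have bzs : b \in z :: s by rewrite inE.
    by right; have [->//|rb] := IH2 b bzs; exact: pbetter_trans ar rb.
  split; first by move: IH1; rewrite !inE orbCA => ->; rewrite orbT.
  move=> b; rewrite !inE orbCA => /orP[/eqP ->|bs]; last by apply: IH2; rewrite inE.
  by case: (pbetter_total a r) => [->|h|h]; [left|rewrite h in ar|right].
rewrite /anchor; have [] := H A (head (0, 0) A).
have hd (s : seq point) : a0 \in s -> head (0, 0) s \in s.
  by case: s => //= x s _; rewrite inE eqxx.
set z := head _ _; have zA : z \in A := hd _ a0A.
move=> h1 h2; split; first by move: h1; rewrite inE => /orP[/eqP ->|].
by move=> b bA; apply: h2; rewrite inE bA orbT.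
Qed.

Lemma anchor_uniq (A : cfg) r : r \in A -> (forall b, b \in A -> b = r \/ pbetter r b) ->
  anchor A = r.
Proof.
move=> rA rbest; have [|aA abest] := @anchorP A; first by apply/fset0Pn; exists r.
have [-> //|h] := abest _ rA; have [//|h'] := rbest _ aA.
by have := pbetter_trans h h'; rewrite pbetter_irr.
Qed.

Lemma count_lt (T : eqType) (p q : pred T) (s : seq T) x : subpred p q ->
  x \in s -> ~~ p x -> q x -> (count p s < count q s)%N.
Proof.
move=> pq + px qx; elim: s => //= y s IH; rewrite inE => /orP[/eqP <-|/IH h].
  by rewrite (negbTE px) qx ltnS sub_count.
by rewrite -addnS leq_add //; case: (p y) (pq y) => // ->.
Qed.

Definition deg (A : cfg) (v : point) : nat := count (fun i => nb v i \in A) (iota 0 6).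

Lemma sum_deg_ge (A : cfg) : is_connected A -> A != fset0 ->
  (2 * (#|` A| - 1) <= \sum_(v <- A) deg A v)%N.
Proof.
move=> cA /fset0Pn[a aA]; apply: (grow_ind (Q := fun B : cfg =>
  (2 * (#|` B| - 1) <= \sum_(v <- B) deg B v)%N) cA aA); first by rewrite cardfs1.
move=> B b c BA bB cB bc IH; have /adjP[j j6 ej] := bc.
rewrite cardfsU1 cB add1n subn1 /= big_fsetU1 //=.
have c1 : (0 < deg (c |` B)%fset c)%N.
  rewrite -has_count; move: bc; rewrite adj_sym => /adjP[i i6 ei].
  by apply/hasP; exists i; rewrite ?mem_iota // -ei !inE bB orbT.
have sub v : (deg B v <= deg (c |` B)%fset v)%N.
  by apply: sub_count => i h; rewrite !inE h orbT.
have b1 : (deg B b < deg (c |` B)%fset b)%N.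
  apply: (count_lt (x := j)); rewrite ?mem_iota //=.
  - by move=> i h; rewrite !inE h orbT.
  - by rewrite -ej.
  - by rewrite -ej !inE eqxx.
move: IH; rewrite (big_fsetD1 b) //= [in X in _ -> X](big_fsetD1 b) //=.
have : (\sum_(v <- (B `\ b)%fset) deg B v <= \sum_(v <- (B `\ b)%fset) deg (c |` B)%fset v)%N.
  exact: leq_sum.
have B0 : (0 < #|` B|)%N by rewrite cardfs_gt0; apply/fset0Pn; exists b.
move: (#|` B|) (deg (c |` B)%fset c) (deg (c |` B)%fset b) (deg B b) c1 b1 B0; clear.
by move: (\sum_(_ <- _) _)%N (\sum_(_ <- _) _)%N; lia.
Qed.

Lemma iter_period (T : Type) (f : T -> T) x k i : iter k.+1 f x = x ->
  iter i f x = iter (i %% k.+1) f x.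
Proof.
move=> h; rewrite {1}(divn_eq i k.+1) addnC iterD; congr iter.
by elim: (i %/ k.+1)%N => // q IH; rewrite mulSn iterD IH.
Qed.

(** Around a particle, each occupied direction is followed by an occupied one, counted by [tri], or
    by an empty one, which is a corner. So the degree is [tri] plus the number of corners; summing
    over particles, the degrees give at least 2(n - 1) by connectedness, and the corners are at most
    as many as the steps of the walk. *)
Lemma perimeter_ge (A : cfg) : is_connected A -> no_holes A -> (1 < #|` A|)%N ->
  (2 * (#|` A| - 1) <= perimeter A + \sum_(v <- A) tri A v)%N.
Proof.
move=> cA nh n1.
have A0 : A != fset0 by rewrite -cardfs_gt0 ltnW.
have [aA abest] := anchorP A0.
(* Direction 0 raises 2x + y by 2, and the anchor maximizes this quantity. *)
have a0 : nb (anchor A) 0 \notin A.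
  apply/negP => /abest[/eqP|]; first by rewrite (negbTE (nb_neq _ _)).
  rewrite /pbetter /nb /padd /=; clear; lia.
pose C := [seq st <- [seq (v, s) | v <- A, s <- iota 0 6] | corner A st].
have CP : (size C <= perimeter A)%N.
  have [j j6 jA] := connected_nb cA n1 aA.
  rewrite /perimeter ifT; last by apply/hasP; exists j; rewrite ?mem_iota.
  set s1 := wstep A _; set k := find _ _.
  have c1 : corner A s1 by have [|k' [_ _ _ ]] := wstepP aA a0; first by exists j.
  have [k6|k6] := leqP (6 * #|` A|)%N k.
    apply: leqW; apply: leq_trans k6; rewrite size_filter (leq_trans (count_size _ _)) //.
    by rewrite size_allpairs size_iota mulnC.
  have ret : iter k.+1 (wstep A) s1 = s1.
    have h : has (fun k => iter k.+1 (wstep A) s1 == s1) (iota 0 (6 * #|` A|)%N).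
      by rewrite has_find size_iota.
    have /eqP := nth_find 0%N h; rewrite -/k nth_iota ?add0n //.
  apply: (@leq_trans (size [seq iter i (wstep A) s1 | i <- iota 0 k.+1])).
    apply: uniq_leq_size.
      apply: filter_uniq; apply: allpairs_uniq; rewrite ?fset_uniq ?iota_uniq //.
      by move=> [? ?] [? ?] _ _.
    move=> st; rewrite mem_filter => /andP[cst _].
    have [i ->] := orbit_all cA nh c1 ret cst.
    by apply/mapP; exists (i %% k.+1)%N; [rewrite mem_iota /= ltn_mod|exact: iter_period].
  by rewrite size_map size_iota.
apply: leq_trans (sum_deg_ge cA A0) _; apply: leq_trans (leq_add CP (leqnn _)).
have -> : size C = (\sum_(v <- A) count (fun s => corner A (v, s)) (iota 0 6))%N.
  rewrite size_filter -sum1_count big_mkcond big_allpairs; apply: eq_bigr => v _.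
  by rewrite -[RHS]sum1_count [RHS]big_mkcond.
rewrite -big_split /= leq_eqVlt; apply/orP; left; apply/eqP.
apply: eq_big_seq => v vA; rewrite /deg /tri /corner /= vA /=.
rewrite -!/(nb v _).
have -> : nb v 6 = nb v 0 by [].
have -> : nb v 7 = nb v 1 by [].
have -> : nb v 8 = nb v 2 by [].
have -> : nb v 9 = nb v 3 by [].
have -> : nb v 10 = nb v 4 by [].
case: (nb v 0 \in A); case: (nb v 1 \in A); case: (nb v 2 \in A); case: (nb v 3 \in A);
  by case: (nb v 4 \in A); case: (nb v 5 \in A).
Qed.

(** * Detailed balance *)

Definition trisum (A : cfg) : nat := \sum_(v <- A) tri A v.

Lemma sum_pick (A : cfg) (p : point) (Q : point -> nat) :
  (\sum_(v <- A) (v == p) * Q v = (p \in A) * Q p)%N.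
Proof.
have [pA|pA] := boolP (p \in A).
  rewrite (big_fsetD1 p) //= eqxx big_seq big1 ?addn0 // => v.
  by rewrite !inE => /andP[/negbTE -> _].
by rewrite big_seq big1 // => v vA; case: eqP => // e; rewrite -e vA in pA.
Qed.

Lemma sum_pick_nb (A : cfg) (p : point) k :
  (\sum_(v <- A) (v == p) * (nb v k \in A) = (p \in A) * (nb p k \in A))%N.
Proof. exact: (sum_pick A p (fun v => nb v k \in A)). Qed.

Lemma triE A v : tri A v = (\sum_(i < 6) (nb v i \in A) * (nb v i.+1 \in A))%N.
Proof. by rewrite /tri !big_ord_recl big_ord0 /= -!mulnb. Qed.

Lemma nb_eq_rev v a i : (nb v i == a) = (v == nb a (i + 3)).
Proof.
apply/eqP/eqP => [<-|->]; first by rewrite nbK.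
by rewrite -[RHS](nbK a (i + 3)) -addnA -[(3 + 3)%N]/(6 + 0)%N nb6 addn0.
Qed.

(** Each new face is counted once at [a] and once at each of its other two vertices. Seen from such
    a vertex [v], the site [a] is either the first or the second of the two consecutive neighbours,
    which gives the two sums in [split3]. *)
Lemma trisum_add (A : cfg) a : a \notin A ->
  trisum (a |` A)%fset = (trisum A + 3 * tri (a |` A)%fset a)%N.
Proof.
move=> aA; have mem x : (x \in (a |` A)%fset) = (x == a) || (x \in A) by rewrite !inE.
have ta : tri (a |` A)%fset a = tri A a.
  by rewrite !triE; apply: eq_bigr => i _; rewrite !mem !(negbTE (nb_neq _ _)).
have split3 v : tri (a |` A)%fset v = (tri A v + (\sum_(i < 6) (v == nb a (i + 3)) * (nb v i.+1 \in A)
     + \sum_(i < 6) (v == nb a (i + 4)) * (nb v i \in A)))%N.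
  rewrite !triE -!big_split /=; apply: eq_bigr => i _; rewrite !mem.
  have -> : (v == nb a (i + 4)) = (nb v i.+1 == a) by rewrite nb_eq_rev addSn -addnS.
  rewrite -(nb_eq_rev v a i); case: (nb v i =P a) => [e|_] /=; case: (nb v i.+1 =P a) => [e'|_] /=.
  - by move: (adj_turn v i); rewrite e e' adj_irr.
  - by rewrite e (negbTE aA); case: (nb v i.+1 \in A).
  - by rewrite e' (negbTE aA); case: (nb v i \in A).
  - by rewrite !mul0n !addn0.
have e1 i : nb (nb a (i + 3)) i.+1 = nb a (i + 2).
  rewrite nbD /nb; congr padd.
  by elim/dir_lt6: i => // q r; rewrite -!addnA -?addnS !dirM.
have e2 i : nb (nb a (i + 4)) i = nb a (i + 5).
  rewrite nbD /nb; congr padd.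
  by elim/dir_lt6: i => // q r; rewrite -!addnA !dirM.
have S1 : (\sum_(v <- A) \sum_(i < 6) (v == nb a (i + 3)) * (nb v i.+1 \in A) = tri A a)%N.
  rewrite exchange_big /= triE; under eq_bigr do rewrite sum_pick_nb e1.
  by rewrite !big_ord_recl !big_ord0 /= /bump /=; offsets; do 6!case: (_ \in A).
have S2 : (\sum_(v <- A) \sum_(i < 6) (v == nb a (i + 4)) * (nb v i \in A) = tri A a)%N.
  rewrite exchange_big /= triE; under eq_bigr do rewrite sum_pick_nb e2.
  by rewrite !big_ord_recl !big_ord0 /= /bump /=; offsets; do 6!case: (_ \in A).
rewrite /trisum big_fsetU1 //= ta (eq_bigr _ (fun v _ => split3 v)) !big_split /= S1 S2.
by clear; lia.
Qed.

(** * Translations, normalization and reversal of moves *)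

Section Shift.
Variable c : point.
Definition shift (x : point) : point := psub x c.

Lemma shiftE x : shift x = padd (- c.1, - c.2) x.
Proof. by rewrite /shift /psub /padd; congr pair; rewrite addrC. Qed.

Lemma shift_inj : injective shift.
Proof. by move=> x y; rewrite !shiftE => /padd_inj. Qed.

Lemma shift_adj a b : adj (shift a) (shift b) = adj a b.
Proof. by rewrite !shiftE adj_padd. Qed.

Lemma shift_nb v i : shift (nb v i) = nb (shift v) i.
Proof. by rewrite !shiftE /nb paddA. Qed.

Lemma trisum_shift (A : cfg) : trisum (gset shift A) = trisum A.
Proof.
rewrite /trisum /gset big_imfset /=; last by move=> x y _ _ /shift_inj.
by apply: eq_bigr => v _; rewrite !triE; apply: eq_bigr => i _;
  rewrite -!shift_nb !mem_gset //; exact: shift_inj.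
Qed.

Lemma anchor_shift (A : cfg) : A != fset0 -> anchor (gset shift A) = shift (anchor A).
Proof.
move=> A0; have [aA abest] := anchorP A0.
apply: anchor_uniq; first by rewrite mem_gset //; exact: shift_inj.
move=> _ /gsetP[b bA ->]; have [->|h] := abest b bA; first by left.
by right; rewrite !shiftE pbetter_padd.
Qed.
End Shift.

Lemma normalizeE (A : cfg) : normalize A = gset (shift (anchor A)) A.
Proof. by []. Qed.

Lemma shift_shift (A : cfg) c d : gset (shift d) (gset (shift c) A) = gset (shift (padd c d)) A.
Proof.
apply/fsetP => x; apply/gsetP/gsetP => [[y /gsetP[z zA ->] ->]|[z zA ->]].
  exists z => //; rewrite /shift /psub /padd /=; congr pair; clear; lia.
exists (shift c z); first by apply/gsetP; exists z.
rewrite /shift /psub /padd /=; congr pair; clear; lia.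
Qed.

Lemma normalize_shift c (A : cfg) : normalize (gset (shift c) A) = normalize A.
Proof.
have [->|A0] := eqVneq A fset0.
  have e g : gset g fset0 = fset0.
    by apply/eqP; rewrite -[_ == _]negbK; apply/negP => /fset0Pn[x /gsetP[y]]; rewrite inE.
  by rewrite !normalizeE !e.
rewrite !normalizeE anchor_shift // shift_shift; congr (gset (shift _) A).
exact: padd_subK.
Qed.

Lemma anchor_normalize (A : cfg) : A != fset0 -> anchor (normalize A) = (0, 0).
Proof. by move=> A0; rewrite normalizeE anchor_shift // /shift /psub !subrr. Qed.

Lemma movedK (A : cfg) l l' : l \in A -> l' \notin A -> moved (moved A l l') l' l = A.
Proof.
move=> lA l'A; apply/fsetP => x; rewrite !in_moved.
case: (x =P l) => [->|xl] /=; first by rewrite lA.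
by case: (x =P l') => [->|] //=; rewrite (negbTE l'A).
Qed.

Lemma trisum_moved (A : cfg) l l' : l \in A -> l' \notin A ->
  (trisum (moved A l l') + 3 * tri A l = trisum A + 3 * tri (moved A l l') l')%N.
Proof.
move=> lA l'A; pose B := (A `\ l)%fset.
have eA : A = (l |` B)%fset by rewrite fsetD1K.
have h1 : l \notin B by rewrite !inE eqxx.
have h2 : l' \notin B by rewrite !inE (negbTE l'A) andbF.
have := trisum_add h1; rewrite -eA => ->; by rewrite trisum_add // addnAC.
Qed.

Lemma no_hole_nb (A : cfg) x : no_holes A -> x \notin A -> exists2 j, (j < 6)%N & nb x j \notin A.
Proof.
move=> nh xA; apply: contrapT => H; apply: (nh [set x]%classic).
have full j : nb x j \in A.
  rewrite -nb_mod; apply: contrapT => /negP h; apply: H; exists (j %% 6)%N => //.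
  by rewrite ltn_mod.
split; first exact: finite_set1.
- by move=> y /= ->; apply/negP.
- by move=> a b /= -> ->; apply: lpath_refl.
move=> K finK cK KA xK; apply/seteqP; split=> // y Ky /=.
have Kx : K x by apply: xK.
have [s [ps ls Ss]] := cK x y Kx Ky.
case: s ps ls Ss => [|z s] //= /andP[/adjP[j j6 ez] _] _ /(_ z).
by rewrite inE eqxx => /(_ isT) /KA; rewrite /occ /= ez full.
Qed.

(** Properties 1 and 2 are symmetric in the two sites and ignore what occupies them. Only the
    condition on five neighbours needs an argument: [l'] had an empty neighbour besides [l], for
    otherwise it would have been a hole, and after the move [l] is empty as well. *)
Lemma move_rev (A : cfg) l i : no_holes A -> l \in A -> move_allowed A l (nb l i) ->
  move_allowed (moved A l (nb l i)) (nb l i) l.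
Proof.
move=> nh lA [l'A d5 pr]; set l' := nb l i in l'A d5 pr *; set M := moved A l l'.
have ll' : l != l' by rewrite eq_sym nb_neq.
have lM : l \notin M by rewrite in_moved eqxx /= orbF.
have memM x : x != l -> x != l' -> (x \in M) = (x \in A).
  by move=> xl xl'; rewrite in_moved (negbTE xl') xl.
have nadj x y : adj x y -> y != x by apply: contraTneq => ->; rewrite adj_irr.
split=> //.
  have [j j6 jA] := no_hole_nb nh l'A.
  apply: (@deg_neq5 M l' (i + 3) j).
  - apply: contraNneq jA => e; rewrite -(nb_eqmod _ e) nbK //.
  - by rewrite nbK.
  - rewrite memM ?nb_neq //; by apply: contraNneq jA => ->.
have eS : [fset x in M | adj l' x && adj l x]%fset = [fset x in A | adj l x && adj l' x]%fset.
  apply/fsetP => x; rewrite !inE /= [adj l' x && _]andbC.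
  case h1: (adj l x) => /=; rewrite ?andbF //; case h2: (adj l' x) => /=; rewrite ?andbF // !andbT.
  by rewrite -in_moved memM // nadj.
case: pr => [[S12 Nu]|[S0 ex ex' c c']]; [left|right].
  have eN : [fset x in M | (adj l' x || adj l x) && (x != l') && (x != l)]%fset =
            [fset x in A | (adj l x || adj l' x) && (x != l) && (x != l')]%fset.
    apply/fsetP => x; rewrite !inE [adj l' x || _]orbC -in_moved.
    case h1: (x == l) => /=; rewrite ?andbF //; case h2: (x == l') => /=; rewrite ?andbF //.
    by rewrite memM ?h1 ?h2.
  by rewrite /property1 eS eN.
have side u v : (u = l /\ v = l') \/ (u = l' /\ v = l) ->
    [set x | [/\ x \in M, adj u x & x != v]]%classic = [set x | [/\ x \in A, adj u x & x != v]]%classic.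
  move=> uv; apply/seteqP; split=> x /= [xA ux xv]; split=> //; move: xA; rewrite memM //;
   by case: uv (nadj _ _ ux) xv => [[-> ->]|[-> ->]].
split; rewrite ?eS //.
- by have [x [xA ux xv]] := ex'; exists x; rewrite memM // nadj.
- by have [x [xA ux xv]] := ex; exists x; rewrite memM // nadj.
- by rewrite side //; right.
- by rewrite side //; left.
Qed.

Definition transit (s t : cfg) (li : point * nat) : bool :=
  `[< move_allowed s li.1 (nb li.1 li.2) >] && (normalize (moved s li.1 (nb li.1 li.2)) == t).

Definition transits (s t : cfg) : seq (point * nat) :=
  [seq li <- [seq (l, i) | l <- s, i <- iota 0 6] | transit s t li].

Lemma mem_transits s t li :
  (li \in transits s t) = [&& li.1 \in s, (li.2 < 6)%N & transit s t li].
Proof.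
rewrite mem_filter andbC andbA; congr (_ && _).
apply/allpairsP/andP => [[[l i] [ls + ->]]|[ls i6]].
  by rewrite mem_iota.
by exists li; rewrite mem_iota; case: li ls i6.
Qed.

Lemma normalized_neq0 n s : (0 < n)%N -> Omega n s -> s != fset0.
Proof. by move=> n0 [_ sn _ _]; rewrite -cardfs_gt0 sn. Qed.

Lemma anchor_Omega n s : (0 < n)%N -> Omega n s -> anchor s = (0, 0).
Proof.
by move=> n0 Os; have [ns _ _ _] := Os; rewrite -ns anchor_normalize // (normalized_neq0 n0 Os).
Qed.

Lemma shift_set_inj (A : cfg) c d : A != fset0 ->
  gset (shift c) A = gset (shift d) A -> c = d.
Proof.
move=> A0 /(congr1 anchor); rewrite !anchor_shift // => e.
move: (congr1 fst e) (congr1 snd e) => /= /addrI/oppr_inj e1 /addrI/oppr_inj e2.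
by rewrite [c]surjective_pairing e1 e2 -surjective_pairing.
Qed.

(** [phi] sends a move to its reverse, expressed in the frame of [t]. It is injective: performing
    the reverse in [t] yields [s] translated by [c li], so the image determines this translation and
    then the move. Applied both ways, it shows that s-to-t and t-to-s moves are equally many. *)
Lemma size_transits n s t : (0 < n)%N -> Omega n s -> Omega n t ->
  (size (transits s t) <= size (transits t s))%N.
Proof.
move=> n0 Os Ot; have [ns _ _ nhs] := Os.
pose c li := anchor (moved s li.1 (nb li.1 li.2)).
pose phi (li : point * nat) := (shift (c li) (nb li.1 li.2), (li.2 + 3) %% 6)%N.
have back li : li \in transits s t ->
   [/\ li.1 \in s, nb li.1 li.2 \notin s, t = gset (shift (c li)) (moved s li.1 (nb li.1 li.2)) &
     moved t (phi li).1 (nb (phi li).1 (phi li).2) = gset (shift (c li)) s].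
  rewrite mem_transits => /and3P[ls _ /andP[/asboolP ok /eqP et]].
  have [ls' _ _] := ok; split=> //.
  rewrite /phi /= nb_mod -shift_nb nbK -et normalizeE -/(c li) -gset_moved ?movedK //.
  exact: shift_inj.
rewrite -(size_map phi); apply: uniq_leq_size.
  rewrite map_inj_in_uniq.
    apply: filter_uniq; apply: allpairs_uniq; rewrite ?fset_uniq ?iota_uniq //.
    by move=> [? ?] [? ?] _ _.
  move=> [l i] [l' i'] h h' e.
  have [ls ls' et em] := back _ h; have [l's l's' et' em'] := back _ h'.
  have ec : c (l, i) = c (l', i').
    by apply: (shift_set_inj (normalized_neq0 n0 Os)); rewrite -em -em' e.
  move: h h' e; rewrite !mem_transits /phi /= => /and3P[_ i6 _] /and3P[_ i'6 _] e.
  have e1 := congr1 fst e; have e2 := congr1 snd e; rewrite /= ec in e1 e2.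
  have ei : i = i'.
    by rewrite -(modn_small i6) -(modn_small i'6); apply/eqP; rewrite -(eqn_modDr 3) e2.
  have en := shift_inj e1; congr pair => //.
  by rewrite -(nbK l i) -(nbK l' i') en ei.
move=> _ /mapP[[l i] h ->]; have [ls ls' et em] := back _ h.
move: (h); rewrite mem_transits => /and3P[_ /= i6 /andP[/asboolP /= ok _]].
rewrite mem_transits /= ltn_mod {1}et mem_gset; last exact: shift_inj.
rewrite in_moved eqxx /=; apply/andP; split; last first.
  rewrite em normalize_shift ns //.
apply/asboolP; rewrite /= nb_mod -shift_nb nbK et.
apply: gset_move; [exact: shift_inj|exact: shift_adj|exact: move_rev].
Qed.

Section Balance.
Variables (R : realFieldType) (mu : R).
Hypothesis mu0 : 0 < mu.

Definition wt (A : cfg) : R := mu ^+ trisum A.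

Lemma wt_gt0 A : 0 < wt A.
Proof. exact: exprn_gt0. Qed.

Lemma wt_normalize A : wt (normalize A) = wt A.
Proof. by rewrite /wt normalizeE trisum_shift. Qed.
End Balance.

Section BalanceR.
Variables (R : realType) (mu : R).
Hypothesis mu0 : 0 < mu.

(** The Metropolis identity: the right-hand side is symmetric in the two configurations. *)
Lemma accept_balance A l l' : l \in A -> l' \notin A ->
  wt mu A * accept (mu ^+ 3) A l l' = Num.min (wt mu A) (wt mu (moved A l l')).
Proof.
move=> lA l'A; rewrite /accept minr_pMr ?ltW ?wt_gt0 // mulr1; congr Num.min.
have mun : mu ^+ 3 != 0 by rewrite expf_neq0 // gt_eqF.
rewrite expfzDr // -exprnP -exprnN mulrA; apply: (mulIf (expf_neq0 (tri A l) mun)).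
rewrite mulfVK ?expf_neq0 ?gt_eqF // /wt -!exprM -!exprD; congr (_ ^+ _).
exact: esym (trisum_moved lA l'A).
Qed.

Lemma trans_balance n s t : (0 < n)%N -> Omega n s -> Omega n t ->
  wt mu s * trans (mu ^+ 3) s t = wt mu t * trans (mu ^+ 3) t s.
Proof.
move=> n0 Os Ot; have [->//|st] := eqVneq s t.
have H s' t' : s' != t' -> wt mu s' * \sum_(l <- s') \sum_(i < 6) stepprob (mu ^+ 3) s' l i t' =
    (size (transits s' t'))%:R * Num.min (wt mu s') (wt mu t').
  move=> st'; rewrite big_distrr /=.
  have -> : (size (transits s' t'))%:R * Num.min (wt mu s') (wt mu t') =
      \sum_(l <- s') \sum_(i <- iota 0 6) if transit s' t' (l, i) then Num.min (wt mu s') (wt mu t') else 0.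
    rewrite /transits size_filter -sum1_count natr_sum big_distrl big_mkcond big_allpairs.
    apply: eq_bigr => l _; apply: eq_bigr => i _; by case: ifP => // _; exact: mul1r.
  apply: eq_big_seq => l ls; rewrite big_distrr /= -(big_mkord xpredT (fun i => wt mu s' * stepprob (mu ^+ 3) s' l i t')).
  apply: eq_bigr => i _; rewrite /stepprob /transit /= (negbTE st') -/(nb l i) mulr0 addr0.
  case: asboolP => ok; last by rewrite mulr0.
  case: eqP => [e|_] /=; last by rewrite !mulr0.
  have [l'A _ _] := ok.
  by rewrite mulr1 accept_balance // -e wt_normalize.
have ets : t != s by rewrite eq_sym.
rewrite /trans mulrCA [RHS]mulrCA H // H // minC.
have [_ -> _ _] := Os; have [_ -> _ _] := Ot.
by congr (_ * (_%:R * _)); apply/eqP; rewrite eqn_leq !(@size_transits n).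
Qed.
End BalanceR.

(** * Stationary measures *)

Section Reversible.
Variables (R : realFieldType) (T : eqType) (W : seq T) (p w : T -> R) (P : T -> T -> R).
Hypotheses (p0 : forall s, s \in W -> 0 <= p s) (w0 : forall s, s \in W -> 0 < w s)
  (P0 : forall s t, s \in W -> t \in W -> 0 <= P s t)
  (P1 : forall s, s \in W -> \sum_(t <- W) P s t <= 1)
  (bal : forall s t, s \in W -> t \in W -> w s * P s t = w t * P t s)
  (stat : forall t, t \in W -> \sum_(s <- W) p s * P s t = p t).

Lemma sum_seq_eq0 (F : T -> R) : (forall s, s \in W -> 0 <= F s) -> \sum_(s <- W) F s = 0 ->
  forall s, s \in W -> F s = 0.
Proof.
move=> F0; rewrite big_seq => /eqP; rewrite psumr_eq0 // => /allP h s sW.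
by have := h s sW; rewrite sW /= => /eqP.
Qed.

(** Summing stationarity over all targets returns the total of [p], so the nonnegative losses [p s]
    times (1 - row sum) add up to 0. *)
Lemma stationary_closed s : s \in W -> p s * (1 - \sum_(t <- W) P s t) = 0.
Proof.
apply: (@sum_seq_eq0 (fun u => p u * (1 - \sum_(t <- W) P u t))) => [u uW|]; first by rewrite mulr_ge0 ?p0 // subr_ge0 P1.
under eq_bigr do rewrite mulrBr mulr1 big_distrr /=.
rewrite sumrB exchange_big /= [X in _ - X](eq_big_seq p) ?subrr //.
Qed.

(* The Dirichlet form of p / w vanishes. *)
Lemma reversible_ratio s t : s \in W -> t \in W -> 0 < P s t -> p s / w s = p t / w t.
Proof.
pose f u := p u / w u; pose q u v := w u * P u v.
have pf u : u \in W -> p u = f u * w u by move=> uW; rewrite /f divfK // gt_eqF ?w0.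
have qs u v : u \in W -> v \in W -> q u v = q v u by exact: bal.
have q0 u v : u \in W -> v \in W -> 0 <= q u v.
  by move=> uW vW; rewrite mulr_ge0 ?P0 // ltW ?w0.
(* The row sum is 1 wherever [p u] is nonzero, and elsewhere [f u] vanishes too. *)
have row u : u \in W -> \sum_(v <- W) f u ^+ 2 * q u v = f u * p u.
  move=> uW; have := stationary_closed uW; rewrite mulrBr mulr1 => /subr0_eq e.
  under eq_bigr do rewrite /q mulrA.
  have -> : f u ^+ 2 * w u = f u * p u by rewrite [p u]pf // expr2 mulrA.
  by rewrite -big_distrr /= -mulrA -e.
have D0 : \sum_(u <- W) \sum_(v <- W) q u v * (f u - f v) ^+ 2 = 0.
  have S1 : \sum_(u <- W) \sum_(v <- W) f u ^+ 2 * q u v = \sum_(u <- W) f u * p u.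
    exact: eq_big_seq.
  have S2 : \sum_(u <- W) \sum_(v <- W) f v ^+ 2 * q u v = \sum_(u <- W) f u * p u.
    rewrite exchange_big /= -S1; apply: eq_big_seq => v vW; apply: eq_big_seq => u uW.
    by rewrite qs.
  (* Here stationarity enters: [f u * w u] is [p u], so the inner sum over [u] collapses to
     [p v]. *)
  have S3 : \sum_(u <- W) \sum_(v <- W) f u * f v * q u v = \sum_(u <- W) f u * p u.
    rewrite exchange_big /=; apply: eq_big_seq => v vW; rewrite -[in RHS]stat // big_distrr /=.
    apply: eq_big_seq => u uW; rewrite [in RHS]pf // /q; ring.
  have e u v : q u v * (f u - f v) ^+ 2 = f u ^+ 2 * q u v + f v ^+ 2 * q u v - f u * f v * q u v *+ 2.
    ring.
  under eq_bigr => u _ do under eq_bigr => v _ do rewrite e.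
  under eq_bigr do rewrite sumrB big_split sumrMnl.
  by rewrite sumrB big_split sumrMnl /= S1 S2 S3 mulr2n subrr.
have pos u v : u \in W -> v \in W -> 0 <= q u v * (f u - f v) ^+ 2.
  by move=> uW vW; rewrite mulr_ge0 ?q0 ?sqr_ge0.
move=> sW tW Pst.
have D1 : \sum_(v <- W) q s v * (f s - f v) ^+ 2 = 0.
  apply: (@sum_seq_eq0 (fun u => \sum_(v <- W) q u v * (f u - f v) ^+ 2)) => // u uW.
  by rewrite big_seq sumr_ge0 // => v vW; apply: pos.
have /eqP : q s t * (f s - f t) ^+ 2 = 0.
  by apply: (@sum_seq_eq0 (fun v => q s v * (f s - f v) ^+ 2)) => // v vW; apply: pos.
rewrite mulf_eq0 gt_eqF /=; last by rewrite mulr_gt0 ?w0.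
by rewrite sqrf_eq0 subr_eq0 => /eqP.
Qed.
End Reversible.

(** * Enumeration of the state space and the support of a stationary measure *)

Definition decode n (d : n.-tuple 'I_6) : cfg :=
  [fset x in visits (0, 0) [seq val i | i <- d]]%fset.

Lemma Omega_decode n s : (0 < n)%N -> Omega n s ->
  exists d : (2 * (n - 1)).-tuple 'I_6, s = decode d.
Proof.
move=> n0 Os; have [_ sn cs _] := Os.
have a0 : (0, 0) \in s.
  by rewrite -(anchor_Omega n0 Os); have [] := anchorP (normalized_neq0 n0 Os).
have [ds [sz lt6 es]] := connected_visits cs a0; rewrite sn in sz.
have sz' : size [seq inord i : 'I_6 | i <- ds] == (2 * (n - 1))%N by rewrite size_map sz.
exists (Tuple sz'); apply/fsetP => x; rewrite /decode !inE es /=; congr (x \in visits _ _).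
rewrite -map_comp -[LHS]map_id; apply/eq_in_map => i ids /=.
by rewrite inordK //; move/allP: lt6; apply.
Qed.

Definition Omega_seq n : seq cfg :=
  [seq s <- undup (codom (@decode (2 * (n - 1)))) | `[< Omega n s >]].

Lemma Omega_seq_uniq n : uniq (Omega_seq n).
Proof. by rewrite filter_uniq // undup_uniq. Qed.

Lemma mem_Omega_seq n s : (0 < n)%N -> (s \in Omega_seq n) = `[< Omega n s >].
Proof.
move=> n0; rewrite mem_filter mem_undup; case: asboolP => //= Os.
by have [d ->] := Omega_decode n0 Os; rewrite codom_f.
Qed.

Lemma size_Omega_seq n : (size (Omega_seq n) <= 6 ^ (2 * (n - 1)))%N.
Proof.
rewrite size_filter (leq_trans (count_size _ _)) // (leq_trans (size_undup _)) //.
by rewrite size_codom card_tuple card_ord.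
Qed.

Lemma fsbig_Omega (R : realType) n (E : cfg -> Prop) (F : cfg -> R) : (0 < n)%N ->
  \sum_(s \in [set s | Omega n s /\ E s]%classic) F s = \sum_(s <- Omega_seq n | `[< E s >]) F s.
Proof.
move=> n0; rewrite -[RHS]big_filter [RHS]fsbig_seq; last by rewrite filter_uniq // Omega_seq_uniq.
suff -> : [set s | Omega n s /\ E s]%classic =
    [set` [seq s <- Omega_seq n | `[< E s >]]]%classic by [].
apply/seteqP; split=> s /=.
  by move=> [Os Es]; rewrite mem_filter mem_Omega_seq //; apply/andP; split; apply/asboolP.
by rewrite mem_filter mem_Omega_seq // => /andP[/asboolP Es /asboolP Os].
Qed.

Section Chain.
Variables (R : realType) (mu : R) (n : nat) (pi : cfg -> R).
Hypotheses (mu0 : 0 < mu) (n1 : (1 < n)%N).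
Let lam := mu ^+ 3.
Hypothesis pi_stat : stationary lam n pi.
Let W := Omega_seq n.
Let n0 : (0 < n)%N := ltnW n1.

Let WP s : reflect (Omega n s) (s \in W).
Proof. by rewrite mem_Omega_seq //; exact: asboolP. Qed.

Let sumW (F : cfg -> R) : \sum_(s \in Omega n) F s = \sum_(s <- W) F s.
Proof.
have -> : Omega n = [set s | Omega n s /\ True]%classic by apply/seteqP; split=> s //= [].
by rewrite fsbig_Omega //; apply: eq_bigl => s; apply/asboolP.
Qed.

Let pi_ge0 s : s \in W -> 0 <= pi s.
Proof. by move=> /WP Os; have [h _ _] := pi_stat; exact: h. Qed.

Let pi_stat' t : t \in W -> \sum_(s <- W) pi s * trans lam s t = pi t.
Proof. by move=> /WP Ot; have [_ _ h] := pi_stat; rewrite -h // sumW. Qed.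

Lemma accept_gt0 A l l' : 0 < accept lam A l l'.
Proof. by rewrite /accept lt_min ltr01 exprz_gt0 // exprn_gt0. Qed.

Lemma accept_le1 A l l' : accept lam A l l' <= 1.
Proof. by rewrite /accept ge_min lexx. Qed.

Lemma stepprob_ge0 s l i t : 0 <= stepprob lam s l i t.
Proof.
rewrite /stepprob; case: ifP => _; last exact: ler0n.
by rewrite addr_ge0 // mulr_ge0 ?ler0n ?subr_ge0 ?accept_le1 // ltW // accept_gt0.
Qed.

Lemma trans_ge0 s t : 0 <= trans lam s t.
Proof.
rewrite /trans mulr_ge0 // ?invr_ge0 ?mulr_ge0 //.
by rewrite sumr_ge0 // => l _; rewrite sumr_ge0 // => i _; exact: stepprob_ge0.
Qed.

Let sum_eq (x : cfg) : \sum_(t <- W) (x == t)%:R = (x \in W)%:R :> R.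
Proof.
have [xW|xW] := boolP (x \in W).
  rewrite (bigD1_seq x) ?Omega_seq_uniq //= eqxx big1 ?addr0 // => t.
  by rewrite eq_sym => /negbTE ->.
by rewrite big_seq big1 // => t tW; case: eqP => // e; rewrite e tW in xW.
Qed.

Lemma stepprob_sum s l i : s \in W ->
  1 - \sum_(t <- W) stepprob lam s l i t =
  if `[< move_allowed s l (nb l i) >]
  then accept lam s l (nb l i) * (normalize (moved s l (nb l i)) \notin W)%:R else 0.
Proof.
move=> sW; rewrite /stepprob -/(nb l i); case: asboolP => ok; last first.
  by rewrite sum_eq sW subrr.
rewrite big_split /= -!big_distrr /= !sum_eq sW mulr1.
by case: (_ \in W); rewrite /=; ring.
Qed.

Lemma trans_sum s : s \in W -> 1 - \sum_(t <- W) trans lam s t =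
  (6 * n%:R)^-1 * \sum_(l <- s) \sum_(i < 6) (1 - \sum_(t <- W) stepprob lam s l i t).
Proof.
move=> sW; have /WP[_ sn _ _] := sW.
have n6 : 6 * n%:R != 0 :> R by rewrite mulf_neq0 // pnatr_eq0 // -lt0n.
rewrite /trans -big_distrr /= sn.
under [in RHS]eq_bigr do rewrite sumrB sumr_const card_ord.
rewrite sumrB mulrBr; congr (_ - _).
  rewrite big_const_seq count_predT iter_addr addr0 sn -mulrnA.
  by rewrite -(mulr_natl 1) mulr1 natrM mulVf.
congr (_ * _); rewrite exchange_big /=; apply: eq_bigr => l _.
by rewrite exchange_big.
Qed.

Let defect_ge0 s l i : s \in W -> 0 <= 1 - \sum_(t <- W) stepprob lam s l i t.
Proof.
by move=> sW; rewrite stepprob_sum //; case: ifP => // _; rewrite mulr_ge0 // ltW // accept_gt0.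
Qed.

Let trans_le1 s : s \in W -> \sum_(t <- W) trans lam s t <= 1.
Proof.
move=> sW; rewrite -subr_ge0 trans_sum // mulr_ge0 ?invr_ge0 ?mulr_ge0 //.
by rewrite sumr_ge0 // => l _; rewrite sumr_ge0 // => i _; exact: defect_ge0.
Qed.

Let bal s t : s \in W -> t \in W -> wt mu s * trans lam s t = wt mu t * trans lam t s.
Proof. by move=> /WP Os /WP Ot; exact: (trans_balance mu0 n0). Qed.

(** Where [pi s] is positive the loss of row [s] is 0. It is a sum of nonnegative contributions of
    single moves, and an allowed move out of the state space would contribute its positive
    acceptance probability. *)
Lemma support_closed s l i : s \in W -> 0 < pi s -> l \in s ->
  move_allowed s l (nb l i) ->
  let t := normalize (moved s l (nb l i)) in t \in W /\ pi t / wt mu t = pi s / wt mu s.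
Proof.
rewrite -(nb_mod l i); move: (i %% 6)%N (ltn_pmod i (isT : (0 < 6)%N)) => {}i i6.
move=> sW ps ls ok t; pose j := Ordinal i6.
have n6 : 0 < (6 * n%:R)^-1 :> R by rewrite invr_gt0 mulr_gt0 // ltr0n.
have tW : t \in W.
  have /eqP := stationary_closed pi_ge0 trans_le1 pi_stat' sW.
  rewrite mulf_eq0 gt_eqF //= trans_sum // mulf_eq0 gt_eqF //= => /eqP e0.
  have /eqP : 1 - \sum_(t <- W) stepprob lam s l j t = 0.
    have h l' : l' \in s -> \sum_(i < 6) (1 - \sum_(t <- W) stepprob lam s l' i t) = 0.
      apply: (@sum_seq_eq0 R _ s (fun l' => \sum_(i < 6) (1 - \sum_(t <- W) stepprob lam s l' i t)) _ e0).
      by move=> u _; rewrite sumr_ge0 // => v _; exact: defect_ge0.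
    by apply: (psumr_eq0P _ (h l ls)) => // v _; exact: defect_ge0.
  rewrite stepprob_sum // asboolT // mulf_eq0 gt_eqF ?accept_gt0 //=.
  by rewrite pnatr_eq0 eqb0 negbK.
split=> //; apply/esym; apply: (reversible_ratio pi_ge0 _ _ trans_le1 bal pi_stat') => //.
- by move=> u _; exact: wt_gt0.
- by move=> u v _ _; exact: trans_ge0.
have /WP[_ sn _ _] := sW.
rewrite /trans sn mulr_gt0 // (big_rem l) //= (bigD1 j) //= -addrA ltr_wpDr //.
  rewrite addr_ge0 // sumr_ge0 // => *; rewrite ?sumr_ge0 // => *; exact: stepprob_ge0.
rewrite /stepprob -/(nb l i) asboolT // eqxx mulr1 ltr_wpDr ?accept_gt0 //.
by rewrite mulr_ge0 ?subr_ge0 ?accept_le1.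
Qed.
End Chain.

(** One of the three edges of any triangular face runs along a column, so a face needs two particles
    in the same column. *)
Lemma trisum_thin (L : cfg) : (forall x y, x \in L -> y \in L -> x.1 = y.1 -> x = y) ->
  trisum L = 0%N.
Proof.
move=> thin; rewrite /trisum big_seq big1 // => v vL; rewrite triE.
have no (x y : point) : x.1 = y.1 -> x.2 <> y.2 -> ~~ ((x \in L) && (y \in L)).
  by move=> e1 e2; apply/negP => /andP[xL yL]; apply: e2; rewrite (thin x y).
have n1 : nb v 1 \notin L.
  by have := no v (nb v 1); rewrite vL /nb /padd /= addr0; apply=> //; clear; lia.
have n4 : nb v 4 \notin L.
  by have := no v (nb v 4); rewrite vL /nb /padd /= addr0; apply=> //; clear; lia.
have n23 : ~~ ((nb v 2 \in L) && (nb v 3 \in L)).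
  by apply: no => //=; clear; lia.
have n50 : ~~ ((nb v 5 \in L) && (nb v 6 \in L)).
  by apply: no => //=; clear; lia.
rewrite !big_ord_recl big_ord0 /= /bump /=; move: n1 n4 n23 n50; offsets.
by do 6!case: (_ \in L).
Qed.

Lemma normalize_shiftK (A : cfg) : gset (padd (anchor A)) (normalize A) = A.
Proof.
have e x : padd (anchor A) (shift (anchor A) x) = x by exact: padd_subK.
apply/fsetP => x; apply/gsetP/idP => [[y /gsetP[z zA ->] ->]|xA]; first by rewrite e.
by exists (shift (anchor A) x); rewrite ?e // normalizeE mem_gset //; exact: shift_inj.
Qed.

(* On a communicating class the stationary measure is proportional to
   mu ^ trisum, and the class contains a configuration of weight 1. *)
Lemma stationary_le_wt (R : realType) (mu : R) n (pi : cfg -> R) s : 0 < mu -> (1 < n)%N ->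
  stationary (mu ^+ 3) n pi -> s \in Omega_seq n -> pi s <= wt mu s.
Proof.
move=> mu0 n1 st sW; have n0 := ltnW n1.
have WP A : reflect (Omega n A) (A \in Omega_seq n).
  by rewrite mem_Omega_seq //; exact: asboolP.
have [pi0 pi1 _] := st.
have ws := wt_gt0 mu0 s.
have : 0 <= pi s by apply: pi0; exact/WP.
rewrite le_eqVlt => /orP[/eqP <-|ps]; first exact: ltW.
(* The ratio equals that of [s], which is positive; so [U] stays within the support, where
   [support_closed] applies. *)
pose U (A : cfg) := normalize A \in Omega_seq n /\
  pi (normalize A) / wt mu (normalize A) = pi s / wt mu s.
have Ucard A : U A -> #|` A| = n.
  by move=> [/WP[_ + _ _] _]; rewrite normalizeE card_gset //; exact: shift_inj.
have Uconn A : U A -> is_connected A.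
  move=> [/WP[_ _ + _] _] => c; rewrite -(normalize_shiftK A).
  by apply: gset_connected c; [exact: padd_inj|exact: adj_padd].
have Umove A l i : U A -> l \in A -> move_allowed A l (nb l i) -> U (moved A l (nb l i)).
  move=> [nW e] lA ok; have rho0 : 0 < pi (normalize A) / wt mu (normalize A).
    by rewrite e divr_gt0.
  have pn : 0 < pi (normalize A) by rewrite -(pmulr_lgt0 _ (_ : 0 < (wt mu (normalize A))^-1)) // invr_gt0 wt_gt0.
  have := @support_closed R mu n pi mu0 n1 st (normalize A) (shift (anchor A) l) i nW pn.
  rewrite -shift_nb normalizeE mem_gset; last exact: shift_inj.
  rewrite -gset_moved; last exact: shift_inj.
  move=> /(_ lA (gset_move (@shift_inj _) (@shift_adj _) ok)).
  by rewrite normalize_shift -normalizeE e.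
have Us : U s by have /WP[ns _ _ _] := sW; rewrite /U ns.
have [L [LW eL] thin] := reach_thin n1 Uconn Ucard Umove Us.
have wL : wt mu (normalize L) = 1.
  by rewrite wt_normalize /wt trisum_thin // expr0.
rewrite wL divr1 in eL.
have pL : pi (normalize L) <= 1.
  have sumW : \sum_(t <- Omega_seq n) pi t = 1.
    rewrite -pi1; have -> : Omega n = [set s | Omega n s /\ True]%classic by apply/seteqP; split=> u //= [].
    by rewrite fsbig_Omega //; apply: eq_bigl => u; apply/esym/asboolP.
  rewrite -sumW (big_rem _ LW) /= lerDl big_seq sumr_ge0 // => u /mem_rem/WP; exact: pi0.
by move: pL; rewrite eL ler_pdivrMr // mul1r.
Qed.

Lemma prob_le (R : realType) (mu : R) n (pi : cfg -> R) (E : cfg -> Prop) (x : R) :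
  0 < mu -> (1 < n)%N -> stationary (mu ^+ 3) n pi -> 0 <= x ->
  (forall s, Omega n s -> E s -> wt mu s <= x) ->
  prob n pi E <= 36 ^+ n * x.
Proof.
move=> mu0 n1 st x0 Ex; rewrite /prob fsbig_Omega ?(ltnW n1) //.
apply: (@le_trans _ _ (\sum_(s <- Omega_seq n) x)).
  rewrite [leLHS]big_mkcond [leLHS]big_seq [leRHS]big_seq.
  apply: ler_sum => s sW; case: asboolP => // Es.
  apply: le_trans (stationary_le_wt mu0 n1 st sW) (Ex s _ Es).
  by move: sW; rewrite mem_Omega_seq ?(ltnW n1) // => /asboolP.
rewrite big_const_seq count_predT iter_addr addr0 -[leLHS]mulr_natl ler_wpM2r //.
have -> : (36 : R) = (6 ^ 2)%:R by [].
rewrite -natrX ler_nat (leq_trans (size_Omega_seq n)) // -expnM leq_exp2l // leq_mul2l.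
by rewrite leq_subr.
Qed.

(** * Choice of constants and conclusion *)

Unset Implicit Arguments.

Theorem theorem3 (R : realType) (beta : R) :
  0 < beta < 1 ->
  exists lam_s : R, 0 < lam_s /\ lam_s < Num.sqrt 2 /\
  exists (n_s : nat) (gamma : R), 0 < gamma /\ gamma < 1 /\
  forall (lam : R) (n : nat), 0 < lam -> lam < lam_s -> (n_s < n)%N ->
  forall pi : cfg -> R, stationary lam n pi ->
    prob n pi (fun s => (perimeter s)%:R < beta * (2 * n%:R - 2))
      <= gamma `^ (Num.sqrt n%:R).
Proof.
move=> /andP[b0 b1]; pose d := 1 - beta; have d0 : 0 < d by rewrite subr_gt0.
have c0 : 0 < 72^-1 :> R by rewrite invr_gt0.
have c1 : 72^-1 < 1 :> R by rewrite invf_lt1 // ltr1n.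
(* The exponent cancels the cube root in [mu] and the power [d], so that [mu] to the power [d] is at
   most 1/72. *)
pose lam_s : R := 72^-1 `^ (3 / d).
have ls0 : 0 < lam_s by rewrite powR_gt0.
have ls1 : lam_s <= 1.
  rewrite -(powRr0 72^-1) /lam_s ger_powR ?c0 ?ltW // divr_gt0 //.
exists lam_s; split=> //; split.
  by rewrite (le_lt_trans ls1) // -{1}sqrtr1 ltr_sqrt // ltr1n.
(* From n = 2 on, 2n - 2 is at least n; and 1/2 is 36/72. *)
exists 1%N, 2^-1; split; first by rewrite invr_gt0.
split; first by rewrite invf_lt1 // ltr1n.
move=> lam n lam0 lam_lt n1 pi; pose mu := lam `^ 3^-1.
have mu0 : 0 < mu by rewrite powR_gt0.
have mu3 : mu ^+ 3 = lam.
  by rewrite -powR_mulrn ?ltW // /mu -powRrM mulVf // powRr1 // ltW.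
have mu1 : mu <= 1.
  have -> : 1 = 1 `^ 3^-1 :> R by rewrite powR1.
  by rewrite ge0_ler_powR ?invr_ge0 ?nnegrE ?ltW // (lt_le_trans lam_lt).
have mud : mu `^ d <= 72^-1.
  rewrite /mu -powRrM (le_trans (y := lam_s `^ (3^-1 * d))) //.
    by rewrite ge0_ler_powR ?mulr_ge0 ?invr_ge0 ?nnegrE ?ltW.
  rewrite /lam_s -powRrM (_ : 3 / d * (3^-1 * d) = 1); first by rewrite powRr1 ?lexx // ltW.
  by rewrite mulrACA divff // mulVf ?mulr1 // gt_eqF.
rewrite -mu3 => st.
apply: (le_trans (prob_le mu0 n1 st (x := 72^-1 ^+ n) _ _)).
- by rewrite exprn_ge0 // ltW.
- move=> s [_ sn cs nh] ps.
  have := perimeter_ge cs nh; rewrite sn => /(_ n1) hp.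
  (* The event forces T to exceed [d] times 2n - 2, which is at least [d] times n. *)
  have hT : d * n%:R <= (trisum s)%:R.
    have : (2 * (n - 1))%:R <= (perimeter s)%:R + (trisum s)%:R :> R by rewrite -natrD ler_nat.
    rewrite natrM natrB ?(ltnW n1) // /d.
    have : 2 <= n%:R :> R by rewrite ler_nat.
    move: ps b0 b1; nra.
  rewrite /wt -powR_mulrn ?(ltW mu0) // (le_trans (y := mu `^ (d * n%:R))) //.
    by rewrite ger_powR // mu0.
  by rewrite powRrM powR_mulrn ?powR_ge0 // lerXn2r ?nnegrE ?powR_ge0 ?(ltW c0).
rewrite -exprMn (_ : 36 * 72^-1 = 2^-1 :> R); last by lra.
rewrite -powR_mulrn ?invr_ge0 // ger_powR ?invr_gt0 ?ltr0n //=.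
  by rewrite invf_le1 // ler1n.
rewrite -[leRHS]ger0_norm // -sqrtr_sqr ler_wsqrtr // expr2 ler_peMl // ler1n.
exact: ltnW.
Qed.
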